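(* Let $\mathcal{A}$ be a real fibered affine line arrangement with horizontal lines $\ell_1,\dots,\ell_n$ and vertical lines $\ell'_1,\dots,\ell'_m$. Every global component of the characteristic variety $V(\mathcal{A})$ is contained in $$W(\mathcal{A})=\bigcap_{p\in\pi(\mathcal{S})}\Big\{\rho\in(\mathbb{C}^* )^{n+m}:\ \prod_{\substack{P\in\mathcal{S}\cap\mathbb{C}_p\\ m(P)\ge 3}}\Big(\prod_{\ell\in\mathcal{A}:\,P\in\ell}\rho_\ell-1\Big)=0\Big\},$$ where an empty product is $1$.
   Context: $\mathcal{A}=\{\ell_1,\dots,\ell_n,\ell'_1,\dots,\ell'_m\}$ is a finite arrangement of affine lines in $\mathbb{C}^2$ (coordinates $x,y$), defined over $\mathbb{R}$, with complement $\mathcal{M}(\mathcal{A})$; $\pi(x,y)=x$; $\mathcal{S}$ is the set of singular points of the arrangement (points lying on at least two lines). The vertical lines are $\ell'_j=\pi^{-1}(\xi)$ with $\xi\in\pi(\mathcal{S})$, and the horizontal lines satisfy $\pi(\ell_i)=\mathbb{C}$. ''Fibered'' means: for every $\xi\in\pi(\mathcal{S})$ the line $\pi^{-1}(\xi)$ belongs to $\mathcal{A}$ (so $\pi$ makes $\mathcal{M}(\mathcal{A})$ a fiber bundle over $\mathbb{C}\setminus\pi(\mathcal{S})$). Put $\mathbb{C}_p=\pi^{-1}(p)$, and let $m(P)$ be the multiplicity of $P$, i.e. the number of lines of $\mathcal{A}$ through $P$. For $\rho=(\rho_\ell)_{\ell\in\mathcal{A}}\in(\mathbb{C}^* )^{n+m}$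 let $\mathcal{L}_\rho$ be the rank one complex local system on $\mathcal{M}(\mathcal{A})$ in which a standard (positively oriented) small circle around $\ell$ acts as multiplication by $\rho_\ell$. The characteristic variety is $V(\mathcal{A})=\{\rho:\ \dim H_1(\mathcal{M}(\mathcal{A});\mathcal{L}_\rho)>0\}$. A global component of $V(\mathcal{A})$ is an irreducible component not contained in any coordinate torus $\{\rho_\ell=1\}$, $\ell\in\mathcal{A}$. *)

(* Defs.v *)
From HB Require Import structures.
From mathcomp Require Import all_boot all_order all_algebra.
From mathcomp Require Import all_classical all_reals all_analysis.
From mathcomp Require Import complex.
From mathcomp Require mpoly.

Set Implicit Arguments.
Unset Strict Implicit.
Unset Printing Implicit Defensive.

Import Order.TTheory GRing.Theory Num.Theory.
Import numFieldNormedType.Exports.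

Local Open Scope classical_set_scope.
Local Open Scope ring_scope.

(* R[i] itself carries no canonical topology; declaring it as a
   numClosedFieldType gives it the one induced by its norm. *)
Definition CC (R : realType) : numClosedFieldType := R[i].

Definition RtoC (R : realType) (a : R) : CC R := (a%:C)%C.

Definition unit_circle (R : realType) (t : R) : CC R :=
  (cos (2 * pi * t) +i* sin (2 * pi * t))%C.

Definition std_simplex (R : realType) (k : nat) : set 'rV[R]_k.+1 :=
  [set x | (forall i, 0 <= x 0 i) /\ \sum_i x 0 i = 1].

Definition simplex (R : realType) (k : nat) : topologicalType :=
  set_type (@std_simplex R k).

Section SimplexMaps.
Variables (R : realType) (p q : nat) (f : 'I_p.+1 -> 'I_q.+1).

Definition push_row (x : 'rV[R]_p.+1) : 'rV[R]_q.+1 :=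
  \row_j \sum_(i | f i == j) x 0 i.

Lemma push_row_simplex (x : simplex R p) :
  push_row (val x) \in @std_simplex R q.
Proof.
case: x => x /= /set_mem[x0 x1]; apply/mem_set; split => [j|].
  by rewrite mxE sumr_ge0.
under eq_bigr do rewrite mxE.
by rewrite -x1 (partition_big f xpredT).
Qed.

(* The affine map between standard simplices sending vertex i to vertex f i. *)
Definition simplex_map (x : simplex R p) : simplex R q :=
  exist (fun y => y \in @std_simplex R q) _ (push_row_simplex x).

Lemma push_row_continuous : continuous push_row.
Proof.
move=> x A [/= B Bn BA].
have cvg_entry i j : push_row y i j @[y --> x] --> push_row x i j.
  have -> : (fun y => push_row y i j) = (fun y => \sum_(k | f k == j) y 0 k).
    by apply/funext => y; rewrite mxE.
  rewrite mxE; apply: (@cvg_big _ _ _ _ _ _ _ (nbhs x)) => [|k _].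
    by move=> z; apply: cvgD; [exact: cvg_fst|exact: cvg_snd].
  exact: (@coord_continuous R _ _ 0 k x).
have : \forall y \near x, forall ij : 'I_1 * 'I_q.+1,
    B ij.1 ij.2 (push_row y ij.1 ij.2).
  have FF : Filter (nbhs x) by exact: nbhs_filter.
  apply: (@filter_forall _ ('I_1 * 'I_q.+1)%type _ (nbhs x) FF) => -[i j] /=.
  exact: cvg_entry (Bn i j).
by apply: filterS => y By; apply: BA => i j; exact: (By (i, j)).
Qed.

Lemma simplex_map_continuous : continuous simplex_map.
Proof.
apply: continuous_comp_initial => x.
apply: (@continuous_comp _ _ _ (set_val : simplex R p -> _) push_row).
  exact: initial_continuous.
exact: push_row_continuous.
Qed.

HB.instance Definition _ :=
  @isContinuous.Build (simplex R p) (simplex R q) simplex_map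
    simplex_map_continuous.

End SimplexMaps.

Definition sing (R : realType) (X : topologicalType) (k : nat) : choiceType :=
  continuousType (simplex R k) X.

Section Homology.
Variables (R : realType) (X : topologicalType).

Definition sing_face (k : nat) (i : 'I_k.+2) (s : sing R X k.+1) : sing R X k :=
  (s : continuousType _ _) \o simplex_map (lift i).

Definition sing_edge01 (k : nat) (s : sing R X k.+1) : sing R X 1 :=
  (s : continuousType _ _) \o simplex_map (@widen_ord 2 k.+2 isT).

(* A functor from the fundamental groupoid of X to one-dimensional complex
   vector spaces, a basis of each fibre being chosen: a path u acts as
   multiplication by [transport u].  A singular 2-simplex s is the same thing as
   a homotopy with fixed end points from [sing_face 1 s] to the concatenation of
   [sing_face 2 s] and [sing_face 0 s], so the last field expresses both
   homotopy invariance and compatibility with concatenation (and, for the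
   constant 2-simplices, that constant paths act trivially). *)
Record local_system := LocalSystem {
  transport : sing R X 1 -> CC R;
  transport_neq0 : forall u, transport u != 0;
  transport_comp : forall s : sing R X 2,
    transport (sing_face (inord 1) s) =
      transport (sing_face ord_max s) * transport (sing_face ord0 s)
}.

Definition is_chain (k : nat) (c : sing R X k -> CC R) : Prop :=
  finite_set [set s | c s != 0].

(* In the simplex s a coefficient lives in the fibre at vertex 0; face 0 does
   not contain this vertex, so its coefficient is transported along the edge
   from vertex 0 to vertex 1. *)
Definition boundary (L : local_system) (k : nat) (c : sing R X k.+1 -> CC R) :
    sing R X k -> CC R :=
  fun t => \sum_(s \in [set: sing R X k.+1])
    c s * (\sum_(i < k.+2 | t == sing_face i s)
             (-1) ^+ i * (if i == ord0 then transport L (sing_edge01 s) else 1)).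

Definition is_cycle (L : local_system) (k : nat) (c : sing R X k.+1 -> CC R) :=
  is_chain c /\ boundary L c = (fun=> 0).

Definition is_boundary (L : local_system) (k : nat) (c : sing R X k -> CC R) :=
  exists2 b : sing R X k.+1 -> CC R, is_chain b & boundary L b = c.

(* dim H_(k+1)(X; L) >= d: some d cycles are linearly independent modulo
   boundaries. *)
Definition homology_dim_ge (L : local_system) (k d : nat) : Prop :=
  exists2 z : 'I_d -> (sing R X k.+1 -> CC R),
    (forall i, is_cycle L (z i)) &
    forall a : 'I_d -> CC R,
      is_boundary L (fun s => \sum_i a i * z i s) -> forall i, a i = 0.

Definition dim_H1_gt0 (L : local_system) : Prop := homology_dim_ge L 0 1.

End Homology.

Section Zariski.
Variables (R : realType) (N : nat).

Definition torus : set ('I_N -> CC R) := [set rho | forall k, rho k != 0].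

(* Monomials are invertible on the torus, so polynomials cut out the same
   subsets as Laurent polynomials. *)
Definition zariski_closed (F : set ('I_N -> CC R)) : Prop :=
  exists E : set (mpoly.mpoly N (CC R)),
    F = [set rho | torus rho /\ forall f, E f -> mpoly.meval rho f = 0].

Definition zariski_irreducible (Z : set ('I_N -> CC R)) : Prop :=
  [/\ Z `<=` torus, Z !=set0 &
    forall F G, zariski_closed F -> zariski_closed G ->
      Z `<=` F `|` G -> Z `<=` F \/ Z `<=` G].

Definition irreducible_component (V Z : set ('I_N -> CC R)) : Prop :=
  [/\ zariski_irreducible Z, Z `<=` V &
    forall Z', zariski_irreducible Z' -> Z' `<=` V -> Z `<=` Z' -> Z' = Z].

End Zariski.

Record real_line (R : realType) := RealLine {
  x_coef : R;
  y_coef : R;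
  const_coef : R;
  coef_neq0 : (x_coef, y_coef) != (0, 0)
}.

Section Arrangement.
Variables (R : realType) (N : nat) (A : 'I_N -> real_line R).
Implicit Types (P v : CC R * CC R) (k : 'I_N).

Definition line k : set (CC R * CC R) :=
  [set P | RtoC (x_coef (A k)) * P.1 + RtoC (y_coef (A k)) * P.2
           + RtoC (const_coef (A k)) = 0].

Definition lines_through P : {set 'I_N} := [set k | `[< line k P >]]%SET.

Definition multiplicity P : nat := #|lines_through P|.

Definition singular_points : set (CC R * CC R) :=
  [set P | (2 <= multiplicity P)%N].

Definition complement : topologicalType :=
  set_type [set P : CC R * CC R | forall k, ~ line k P].

(* The loop t |-> P + exp(2 pi i t) v, where P lies on the k-th line and the
   complex disc { P + z v, |z| <= 1 }, transverse to that line, meets no other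
   line of the arrangement.  On [simplex R 1] the parameter t is the barycentric
   coordinate of vertex 1. *)
Definition is_meridian k (u : sing R complement 1) : Prop :=
  exists P v,
    [/\ line k P, ~ line k (P.1 + v.1, P.2 + v.2),
      forall j, j != k -> forall z : CC R, `|z| <= 1 ->
        ~ line j (P.1 + z * v.1, P.2 + z * v.2) &
      forall t : simplex R 1,
        let z := unit_circle (val t 0 1) in
        val ((u : continuousType _ _) t) = (P.1 + z * v.1, P.2 + z * v.2)].

Definition has_monodromy (rho : 'I_N -> CC R) (L : local_system R complement) :=
  forall k u, is_meridian k u -> transport L u = rho k.

(* [has_monodromy rho L] determines L up to isomorphism. *)
Definition characteristic_variety : set ('I_N -> CC R) :=
  [set rho | torus rho /\
    exists2 L : local_system R complement, has_monodromy rho L & dim_H1_gt0 L].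

Definition global_component (Z : set ('I_N -> CC R)) : Prop :=
  irreducible_component characteristic_variety Z /\
  forall k, ~ Z `<=` [set rho | rho k = 1].

Definition W_variety : set ('I_N -> CC R) :=
  [set rho | torus rho /\
    forall p, (fst @` singular_points) p ->
      \big[*%R/1]_(P \in [set P | [/\ singular_points P, P.1 = p &
                                     (3 <= multiplicity P)%N]])
        (\prod_(k in lines_through P) rho k - 1) = 0].

End Arrangement.

(* The lines [A (lshift m i)] are the horizontal ones, the lines
   [A (rshift n j)] the vertical ones. *)
Definition real_fibered_arrangement (R : realType) (n m : nat)
    (A : 'I_(n + m) -> real_line R) : Prop :=
  [/\ injective (line A),
      forall i : 'I_n, fst @` line A (lshift m i) = setT,
      forall j : 'I_m, exists2 xi : CC R, (fst @` singular_points A) xi &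
        line A (rshift n j) = fst @^-1` [set xi] &
      forall xi : CC R, (fst @` singular_points A) xi ->
        exists k, line A k = fst @^-1` [set xi]].

(* Main.v *)
(* By irreducibility it is enough to consider the rho of a global component with
   all rho_k <> 1, and to show that if L_rho has nonzero first homology and p is
   in pi(S), then prod_(l through P) rho_l = 1 for some P over p with m(P) >= 3.

   A linear form on 1-chains that kills the boundaries but not a given cycle is a
   cocycle, i.e. an extension of L_rho to a functor from the fundamental
   groupoid to affine maps of the complex line; the cycle is a boundary as soon
   as this functor has a flat section (a compatible choice of fixed points).
   Suppose that no product at a point over p is 1.
   - On a fibre close to that of p, each point lies on a loop with monodromy
     <> 1 that commutes with everything near it: a small circle around the
     vertical line, or, near a multiple point P, the rotation around P, whose
     monodromy is the product of rho over all lines through P (this is where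
     the arrangement being real is used).  The fixed points of these loops fit
     together into a flat section on the fibre.
   - The projection is locally trivial off pi(S), so flat sections on one
     fibre extend to nearby fibres, hence to all fibres.  They are unique
     because some horizontal line has rho_i <> 1, hence they glue. *)

Require Import Defs.
From HB Require Import structures.
From mathcomp Require Import all_boot all_order all_algebra.
From mathcomp Require Import all_classical all_reals all_analysis.
From mathcomp Require Import complex ring lra.
From mathcomp Require mpoly.

Set Implicit Arguments.
Unset Strict Implicit.
Unset Printing Implicit Defensive.

Import Order.TTheory GRing.Theory Num.Theory.
Import numFieldNormedType.Exports.

Local Open Scope classical_set_scope.
Local Open Scope ring_scope.

(** * Complex numbers and continuity *)

(** The fundamental group is never presented: all loops are explicit, and the only relations used
    come from triangles and squares mapped into the complement. What shapes the proof is that no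
    single family of loops serves a whole fibre. A circle of constant height around the vertical
    line may cross a horizontal line when it starts near one. Near a point with a single horizontal
    line the circle is therefore tilted parallel to that line; its monodromy is still that of the
    vertical line, so nothing is asked of the product at a double point, and only m(P) >= 3 enters
    [W_variety]. Several lines through P admit no common tilt, and the rotation around P takes over.
    Where the constant-height family meets another one, the loops of the latter stay in the domain
    of the flat section of the former; its value is then fixed by these loops, so the two sections
    agree. The estimates use three scales e, K e, d: radius in the base, bound for the displacement
    of the lines over it, and lower bound for the gaps between distinct heights. *)

Section ComplexNumbers.
Variable R : realType.
Implicit Types (x y z : CC R) (a b : R).

Definition cabs z : R := ComplexField.Normc.normc (z : R[i]).

Lemma normrE_cabs z : `|z| = RtoC (cabs z).
Proof. by case: z. Qed.

Lemma cabs_ge0 z : 0 <= cabs z.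
Proof. by case: z => a b; exact: sqrtr_ge0. Qed.

Lemma cabsD x y : cabs (x + y) <= cabs x + cabs y.
Proof. exact: le_normcD. Qed.

Lemma cabsN z : cabs (- z) = cabs z.
Proof. exact: normcN. Qed.

Lemma cabsB x y : cabs (x - y) = cabs (y - x).
Proof. by rewrite -cabsN opprB. Qed.

Lemma cabsM x y : cabs (x * y) = cabs x * cabs y.
Proof. exact: ComplexField.Normc.normcM. Qed.

Lemma cabs0 : cabs 0 = 0.
Proof. exact: ComplexField.Normc.normc0. Qed.

Lemma cabs_eq0 z : cabs z = 0 -> z = 0.
Proof. exact: ComplexField.Normc.eq0_normc. Qed.

Lemma cabs_gt0 z : z != 0 -> 0 < cabs z.
Proof.
by move=> z0; rewrite lt_neqAle cabs_ge0 andbT eq_sym; apply: contra_neq z0 => /cabs_eq0.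
Qed.

Lemma cabs_lt_dist x y z a b : cabs (x - y) < a -> cabs (y - z) < b -> cabs (x - z) < a + b.
Proof.
move=> h1 h2; have -> : x - z = (x - y) + (y - z) by ring.
by apply: le_lt_trans (cabsD _ _) _; apply: ltrD.
Qed.

Lemma RtoCD a b : RtoC (a + b) = RtoC a + RtoC b.
Proof. exact: (rmorphD (real_complex R)). Qed.
Lemma RtoCN a : RtoC (- a) = - RtoC a.
Proof. exact: (rmorphN (real_complex R)). Qed.
Lemma RtoCB a b : RtoC (a - b) = RtoC a - RtoC b.
Proof. exact: (rmorphB (real_complex R)). Qed.
Lemma RtoCM a b : RtoC (a * b) = RtoC a * RtoC b.
Proof. exact: (rmorphM (real_complex R)). Qed.
Lemma RtoC0 : RtoC 0 = 0 :> CC R.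
Proof. by []. Qed.
Lemma RtoC1 : RtoC 1 = 1 :> CC R.
Proof. by []. Qed.
Lemma RtoC_inj : injective (@RtoC R).
Proof. by move=> a b []. Qed.

Lemma cabs_RtoC a : cabs (RtoC a) = `|a|.
Proof. by rewrite /cabs /= expr0n addr0 sqrtr_sqr. Qed.

Lemma cabs_unit t : cabs (unit_circle t : CC R) = 1.
Proof. by rewrite /cabs /= cos2Dsin2 sqrtr1. Qed.

Lemma unit_circle0 : unit_circle 0 = 1 :> CC R.
Proof. by rewrite /unit_circle mulr0 cos0 sin0. Qed.

Lemma unit_circle1 : unit_circle 1 = 1 :> CC R.
Proof. by rewrite /unit_circle mulr1 mulr_natl cos2pi sin2pi. Qed.

Lemma unit_circle_neq0 t : unit_circle t != 0 :> CC R.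
Proof.
by apply/eqP => e; have := cabs_unit t; rewrite e cabs0 => /esym/eqP; rewrite oner_eq0.
Qed.

Lemma RtoC_continuous : continuous (@RtoC R).
Proof.
move=> a; apply/cvgrPdist_lt => e e0.
have [eI eR] : complex.Im (e : R[i]) = 0 /\ 0 < complex.Re (e : R[i]).
  by move: e0; rewrite ltcE /= => /andP[/eqP -> ->].
have -> : e = RtoC (complex.Re (e : R[i])).
  by case: (e : R[i]) eI => p q /= ->.
near=> b; rewrite -RtoCB normrE_cabs cabs_RtoC ltcR.
near: b; exact: cvgr_dist_lt.
Unshelve. all: end_near. Qed.

Definition CCi : CC R := ('i)%C.

Lemma CC_decomp z : z = RtoC (complex.Re z) + CCi * RtoC (complex.Im z).
Proof. exact: complexE. Qed.

Section Continuity.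
Variable (T : topologicalType).

Lemma continuous_add (K : numFieldType) (f g : T -> K) :
  continuous f -> continuous g -> continuous (fun t => f t + g t).
Proof. by move=> cf cg t; apply: cvgD; [exact: cf|exact: cg]. Qed.

Lemma continuous_opp (K : numFieldType) (f : T -> K) : continuous f -> continuous (fun t => - f t).
Proof. by move=> cf t; apply: cvgN; exact: cf. Qed.

Lemma continuous_mul (K : numFieldType) (f g : T -> K) :
  continuous f -> continuous g -> continuous (fun t => f t * g t).
Proof. by move=> cf cg t; apply: cvgM; [exact: cf|exact: cg]. Qed.

Lemma continuous_RtoC (f : T -> R) : continuous f -> continuous (fun t => RtoC (f t)).
Proof. by move=> cf t; apply: continuous_comp; [exact: cf|exact: RtoC_continuous]. Qed.

Lemma continuous_const (U : topologicalType) (c : U) : continuous (fun _ : T => c).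
Proof. by move=> t; exact: cvg_cst. Qed.

Lemma continuous_pair (U V : topologicalType) (f : T -> U) (g : T -> V) :
  continuous f -> continuous g -> continuous (fun t => (f t, g t)).
Proof. by move=> cf cg t; apply: cvg_pair; [exact: cf|exact: cg]. Qed.

Lemma continuous_fst (U V : topologicalType) (f : T -> U * V) :
  continuous f -> continuous (fun t => (f t).1).
Proof. by move=> cf t; apply: (continuous_comp (cf t)); exact: cvg_fst. Qed.

Lemma continuous_snd (U V : topologicalType) (f : T -> U * V) :
  continuous f -> continuous (fun t => (f t).2).
Proof. by move=> cf t; apply: (continuous_comp (cf t)); exact: cvg_snd. Qed.

Lemma continuous_compose (U V : topologicalType) (f : U -> V) (g : T -> U) :
  continuous f -> continuous g -> continuous (fun t => f (g t)).
Proof. by move=> cf cg t; apply: (continuous_comp (cg t)); exact: cf. Qed.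

Lemma continuous_identity : continuous (fun t : T => t).
Proof. by move=> t. Qed.

End Continuity.

Lemma unit_circle_continuous : continuous (@unit_circle R).
Proof.
have -> : @unit_circle R = fun t => RtoC (cos (2 * pi * t)) + CCi * RtoC (sin (2 * pi * t)).
  by apply/funext => t; rewrite [LHS]CC_decomp.
have c : continuous (fun t : R => 2 * pi * t).
  by apply: continuous_mul; [exact: continuous_const|exact: continuous_identity].
apply: continuous_add; [|apply: continuous_mul; first exact: continuous_const];
  apply: continuous_RtoC.
  by apply: continuous_compose c; exact: continuous_cos.
by apply: continuous_compose c; exact: continuous_sin.
Qed.

Lemma continuous_unit_circle (T : topologicalType) (f : T -> R) :
  continuous f -> continuous (fun t => unit_circle (f t)).
Proof. by apply: continuous_compose; exact: unit_circle_continuous. Qed.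

Lemma nbhs_cabs (T : topologicalType) (f : T -> CC R) (t : T) (e : R) : continuous f -> 0 < e ->
  \forall s \near t, cabs (f s - f t) < e.
Proof.
move=> cf e0; have e0' : 0 < RtoC e by rewrite ltcR.
have /cvgrPdist_lt /(_ _ e0') := cf t.
by apply: filterS => s; rewrite normrE_cabs ltcR cabsB.
Qed.

End ComplexNumbers.

Arguments cabs : simpl never.

Ltac prove_continuous := repeat lazymatch goal with
  | H : continuous ?f |- continuous ?f => exact: H
  | |- continuous (fun _ => ?c) => exact: continuous_const
  | |- continuous (fun t => t) => exact: continuous_identity
  | |- continuous (fun t => (@?f t, @?g t)) => refine (@continuous_pair _ _ _ f g _ _)
  | |- continuous (fun t => @?f t + @?g t) => refine (@continuous_add _ _ f g _ _)
  | |- continuous (fun t => @?f t * @?g t) => refine (@continuous_mul _ _ f g _ _)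
  | |- continuous (fun t => - @?f t) => refine (@continuous_opp _ _ f _)
  | |- continuous (fun t => RtoC (@?f t)) => refine (@continuous_RtoC _ _ f _)
  | |- continuous (fun t => unit_circle (@?f t)) => refine (@continuous_unit_circle _ _ f _)
  | |- continuous (fun t => (@?f t).1) => refine (@continuous_fst _ _ _ f _)
  | |- continuous (fun t => (@?f t).2) => refine (@continuous_snd _ _ _ f _)
  | |- continuous fst => exact: (continuous_fst (@continuous_identity _))
  | |- continuous snd => exact: (continuous_snd (@continuous_identity _))
  | |- continuous -%R => exact: (continuous_opp (@continuous_identity _))
  | |- continuous (@RtoC _) => exact: RtoC_continuous
  | |- continuous (@unit_circle _) => exact: unit_circle_continuous
  end.

(** * Affine local systems and flat sections *)

Section RealInduction.
Variable R : realType.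

(** Connectedness of the interval: the supremum of the initial segments on which [P] holds is
    attained and cannot be smaller than 1. The local hypothesis moves [P] between any two nearby
    parameters, in both directions. *)
Lemma real_induction (P : R -> Prop) : P 0 ->
  (forall t, 0 <= t <= 1 -> exists2 e, 0 < e & forall s s', 0 <= s <= 1 -> 0 <= s' <= 1 ->
    `|s - t| < e -> `|s' - t| < e -> P s -> P s') ->
  P 1.
Proof.
move=> P0 loc.
pose S := [set t : R | 0 <= t <= 1 /\ forall s, 0 <= s <= t -> P s].
have S0 : S 0 by split; [rewrite lexx ler01|move=> s; rewrite -eq_le => /eqP <-].
have S1 : ubound S 1 by move=> t [/andP[_]].
have hs : has_sup S by split; [exists 0|exists 1].
set c := sup S.
have c0 : 0 <= c by apply: ub_le_sup => //; exists 1.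
have c1 : c <= 1 by apply: ge_sup => //; exists 0.
have [|e e0 he] := loc c; first by rewrite c0.
have [t [/andP[t0 t1] tP] tc] := sup_adherent e0 hs.
have tc' : t <= c by apply: ub_le_sup; [exists 1|split => //; rewrite t0].
have Pt : P t by apply: tP; rewrite t0 lexx.
have near_c s : 0 <= s <= 1 -> s < c + e -> P s.
  move=> /andP[s0 s1] sce; have [st|ts] := leP s t; first by apply: tP; rewrite s0.
  apply: (he t s); rewrite ?t0 ?s0 //.
    by rewrite ltr_norml; rewrite -/c in tc; lra.
  by rewrite ltr_norml; rewrite -/c in tc; lra.
have [c1'|/eqP c1'] := eqVneq c 1; first by apply: near_c; rewrite ?ler01 ?lexx // c1' ltrDl.
have {}c1' : c < 1 by rewrite lt_neqAle c1 andbT; apply/eqP.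
pose d := Num.min 1 (c + e / 2).
have dS : S d.
  split; first by rewrite /d le_min ler01 /= ge_min lexx /= addr_ge0 // divr_ge0 // ltW.
  move=> s; rewrite /d le_min => /and3P[s0 s1 sc]; apply: near_c; rewrite ?s0 //; lra.
have : d <= c by apply: ub_le_sup => //; exists 1.
by rewrite /d ge_min; lra.
Qed.

End RealInduction.

Section PathFunctor.
Variables (R : realType).
Notation E := (CC R * CC R)%type.

(** Paths and triangles are continuous on the whole space, and only their values on [0,1] or on the
    standard simplex are constrained; affine reparametrizations then need no subtypes. *)
Definition path_in (U : set E) (f : R -> E) :=
  continuous f /\ forall t, 0 <= t <= 1 -> U (f t).

Definition triangle_in (U : set E) (G : R * R * R -> E) :=
  continuous G /\ forall a b c, 0 <= a -> 0 <= b -> 0 <= c -> a + b + c = 1 -> U (G (a, b, c)).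

Definition edge01 (G : R * R * R -> E) t := G (1 - t, t, 0).
Definition edge12 (G : R * R * R -> E) t := G (0, 1 - t, t).
Definition edge02 (G : R * R * R -> E) t := G (1 - t, 0, t).

(* The path f acts as w |-> tra f + lin f * w, from the fibre over f 1 to the
   fibre over f 0; the values on functions that are not paths in M are junk. *)
Record affine_system (M : set E) := AffineSystem {
  lin : (R -> E) -> CC R;
  tra : (R -> E) -> CC R;
  lin_neq0 : forall f, lin f != 0;
  lin_triangle : forall G, triangle_in M G ->
    lin (edge02 G) = lin (edge01 G) * lin (edge12 G);
  tra_triangle : forall G, triangle_in M G ->
    tra (edge02 G) = tra (edge01 G) + lin (edge01 G) * tra (edge12 G)
}.

Variables (M : set E) (F : affine_system M).

Definition act f w := tra F f + lin F f * w.

Lemma act_triangle G w : triangle_in M G ->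
  act (edge02 G) w = act (edge01 G) (act (edge12 G) w).
Proof. by move=> MG; rewrite /act lin_triangle // tra_triangle //; ring. Qed.

Lemma lin_cst z : M z -> lin F (fun=> z) = 1.
Proof.
move=> Mz; have MG : triangle_in M (fun=> z) by split; [exact: continuous_const|].
have := lin_triangle F MG; rewrite /edge01 /edge02 /edge12 => e.
by apply: (mulfI (lin_neq0 F (fun=> z))); rewrite -e mulr1.
Qed.

Lemma tra_cst z : M z -> tra F (fun=> z) = 0.
Proof.
move=> Mz; have MG : triangle_in M (fun=> z) by split; [exact: continuous_const|].
have := tra_triangle F MG; rewrite /edge01 /edge02 /edge12 lin_cst // mul1r => e.
by apply: (addrI (tra F (fun=> z))); rewrite -e addr0.
Qed.

Lemma act_cst z w : M z -> act (fun=> z) w = w.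
Proof. by move=> Mz; rewrite /act tra_cst // lin_cst // add0r mul1r. Qed.

Definition square_in (U : set E) (h : R * R -> E) :=
  continuous h /\ forall s t, 0 <= s <= 1 -> 0 <= t <= 1 -> U (h (s, t)).

(** The square is cut along its diagonal, which is [edge02] of both triangles; their vertices are
    (0,0), (1,0), (1,1) and (0,0), (0,1), (1,1). *)
Lemma square_triangles h : square_in M h ->
  triangle_in M (fun x : R * R * R => h (x.1.2 + x.2, x.2)) /\
  triangle_in M (fun x : R * R * R => h (x.2, x.1.2 + x.2)).
Proof.
move=> [ch Mh]; split; split.
- by apply: continuous_compose => //; prove_continuous.
- by move=> a b c a0 b0 c0 abc; apply: Mh => /=; lra.
- by apply: continuous_compose => //; prove_continuous.
- by move=> a b c a0 b0 c0 abc; apply: Mh => /=; lra.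
Qed.

Lemma act_square h w : square_in M h ->
  act (fun s => h (s, 0)) (act (fun t => h (1, t)) w) =
  act (fun t => h (0, t)) (act (fun s => h (s, 1)) w).
Proof.
move=> Mh; have [T1 T2] := square_triangles Mh.
have := act_triangle w T1; have := act_triangle w T2; rewrite /edge01 /edge12 /edge02 /=.
have -> : (fun t : R => h (0 + t, t)) = (fun t => h (t, 0 + t)).
  by apply/funext => t; rewrite add0r.
under [fun t : R => h (t + 0, 0)]funext do rewrite addr0.
under [fun t : R => h (0, t + 0)]funext do rewrite addr0.
under [fun t : R => h (1 - t + t, t)]funext do rewrite subrK.
under [fun t : R => h (t, 1 - t + t)]funext do rewrite subrK.
by move=> -> ->.
Qed.

Lemma lin_square h : square_in M h ->
  lin F (fun s => h (s, 0)) * lin F (fun t => h (1, t)) =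
  lin F (fun t => h (0, t)) * lin F (fun s => h (s, 1)).
Proof.
move=> Mh; have := act_square 0 Mh; have := act_square 1 Mh; rewrite /act => e1 e0.
transitivity (act (fun s => h (s, 0)) (act (fun t => h (1, t)) 1) -
              act (fun s => h (s, 0)) (act (fun t => h (1, t)) 0)).
  by rewrite /act; ring.
by rewrite /act e0 e1; ring.
Qed.

Definition subpath (f : R -> E) a b := fun t => f (a + t * (b - a)).

Lemma subpath01 f : subpath f 0 1 = f.
Proof. by apply/funext => t; rewrite /subpath subr0 mulr1 add0r. Qed.

Lemma subpath_in U f a b : path_in U f -> 0 <= a <= 1 -> 0 <= b <= 1 -> path_in U (subpath f a b).
Proof.
move=> [cf Uf] ab01 b01; split; first by apply: continuous_compose => //; prove_continuous.
by move=> t t01; apply: Uf; nra.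
Qed.

Lemma subpath_triangle f a b c : path_in M f ->
  0 <= a <= 1 -> 0 <= b <= 1 -> 0 <= c <= 1 ->
  triangle_in M (fun x : R * R * R => f (x.1.1 * a + x.1.2 * b + x.2 * c)).
Proof.
move=> [cf Mf] a01 b01 c01; split; first by apply: continuous_compose => //; prove_continuous.
by move=> x y z x0 y0 z0 xyz; apply: Mf => /=; nra.
Qed.

(** The triangle is degenerate: it is mapped into the image of [f] by the affine function with
    values a, b, c at the vertices. These may come in any order, so subpaths run backwards as
    well. *)
Lemma act_subpath f a b c w : path_in M f ->
  0 <= a <= 1 -> 0 <= b <= 1 -> 0 <= c <= 1 ->
  act (subpath f a b) (act (subpath f b c) w) = act (subpath f a c) w.
Proof.
move=> Mf a01 b01 c01; have T := subpath_triangle Mf a01 b01 c01.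
have := act_triangle w T; rewrite /edge01 /edge12 /edge02 /subpath /= => e.
have E1 u v : (fun t : R => f (u + t * (v - u))) = (fun t => f ((1 - t) * u + t * v)).
  by apply/funext => t; congr f; ring.
(* The zero terms give each argument the shape of the restriction of the triangle to an edge. *)
rewrite !E1; under [fun t => f ((1 - t) * a + t * b)]funext => t do
  rewrite -[_ + _]addr0 -[X in _ + X](mul0r c).
under [fun t => f ((1 - t) * b + t * c)]funext => t do
  rewrite -[(1 - t) * b]add0r -[X in X + _ + _](mul0r a).
under [fun t => f ((1 - t) * a + t * c)]funext => t do
  rewrite -[(1 - t) * a]addr0 -[X in _ + X + _](mul0r b).
by rewrite e.
Qed.

Definition flat (U : set E) (psi : E -> CC R) :=
  forall f, path_in U f -> psi (f 0) = act f (psi (f 1)).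

Lemma path_sub (U V : set E) f : U `<=` V -> path_in U f -> path_in V f.
Proof. by move=> UV [cf Uf]; split => // t t01; apply/UV/Uf. Qed.

Lemma flat_sub (U V : set E) psi : U `<=` V -> flat V psi -> flat U psi.
Proof. by move=> UV fV f Uf; apply: fV; exact: path_sub Uf. Qed.

Lemma flat_ext (U : set E) psi psi' :
  (forall z, U z -> psi z = psi' z) -> flat U psi -> flat U psi'.
Proof.
by move=> e fl f [cf Uf]; rewrite -!e; [apply: fl|apply: Uf; lra|apply: Uf; lra].
Qed.

(** Real induction along the path: [P t] is the flatness relation between the parameters 0 and t,
    and [act_subpath] composes it with the relation on a short piece inside [W]. *)
Lemma flat_local (U : set E) psi : U `<=` M ->
  (forall z, U z -> exists2 W, nbhs z W & flat (U `&` W) psi) -> flat U psi.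
Proof.
move=> UM loc f Uf; have [cf Uf'] := Uf; have Mf := path_sub UM Uf.
pose P t := psi (f 0) = act (subpath f 0 t) (psi (f t)).
suff : P 1 by rewrite /P subpath01.
apply: real_induction.
  rewrite /P; have -> : subpath f 0 0 = fun=> f 0.
    by apply/funext => t; rewrite /subpath subr0 mulr0 addr0.
  by rewrite act_cst //; apply/UM/Uf'; lra.
move=> t t01; have [W Wz flW] := loc _ (Uf' t t01).
have /nbhs_ballP[e /= e0 be] := cf t _ Wz.
exists e => // s s' s01 s'01 sd s'd; rewrite /P => ->.
have -> : psi (f s) = act (subpath f s s') (psi (f s')).
  have -> : psi (f s) = psi (subpath f s s' 0) by rewrite /subpath mul0r addr0.
  have -> : psi (f s') = psi (subpath f s s' 1) by rewrite /subpath mul1r addrC subrK.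
  apply: flW; have [? Us] := subpath_in Uf s01 s'01.
  split => // r r01; split; first exact: Us.
  apply: be; rewrite /ball /= distrC; move: sd s'd r01.
  rewrite !ltr_norml => /andP[a1 a2] /andP[b1 b2] /andP[r0 r1].
  by have [h|h] := leP s s'; apply/andP; split; nra.
by rewrite act_subpath //; lra.
Qed.

(** The open sets [W] serve to select a local section at each point, while flatness is known on [U],
    which may be larger than the part of [V] in [W] (near a vertical line it leaves the fibre). *)
Lemma flat_glue (I : Type) (U W : I -> set E) (psi : I -> E -> CC R) (V : set E) :
  V `<=` M ->
  (forall z, V z -> exists i, W i z) ->
  (forall i z, W i z -> nbhs z (W i)) ->
  (forall i, V `&` W i `<=` U i) ->
  (forall i, flat (U i) (psi i)) ->
  (forall i j z, V z -> W i z -> W j z -> psi i z = psi j z) ->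
  exists psi', flat V psi'.
Proof.
move=> VM cov opn WU fl agr.
pose psi' z := if pselect (exists i, W i z) is left ex then psi (projT1 (cid ex)) z else 0.
have psi'E i z : V z -> W i z -> psi' z = psi i z.
  move=> Vz Wz; rewrite /psi'; case: pselect => [ex|[]]; last by exists i.
  by case: cid => j Wj /=; apply: agr.
exists psi'; apply: flat_local => // z Vz; have [i Wz] := cov _ Vz.
exists (W i); first exact: opn.
apply: (@flat_ext _ (psi i)); last exact: flat_sub (fl i).
by move=> y [Vy Oy]; rewrite (psi'E i).
Qed.

Definition fixpt f := tra F f / (1 - lin F f).

Lemma fixptP f w : lin F f != 1 -> act f w = w <-> w = fixpt f.
Proof.
move=> l1; have l1' : 1 - lin F f != 0 by rewrite subr_eq0 eq_sym.
rewrite /act /fixpt; split => [e|->]; last by field.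
by apply: (mulIf l1'); rewrite divfK // mulrBr mulr1 -{1}e; ring.
Qed.

Lemma act_fixpt f : lin F f != 1 -> act f (fixpt f) = fixpt f.
Proof. by move=> l1; apply/fixptP. Qed.

(* Two loops of the family at the ends of a path f bound, together with two
   copies of f, a square; so parallel transport along f preserves fixed points. *)
Lemma flat_fixpt (U : set E) (C : E * R -> E) : continuous C ->
  (forall z, C (z, 0) = z) -> (forall z, C (z, 1) = z) ->
  (forall z t, U z -> 0 <= t <= 1 -> M (C (z, t))) ->
  (forall z, U z -> lin F (fun t => C (z, t)) != 1) ->
  flat U (fun z => fixpt (fun t => C (z, t))).
Proof.
move=> cC C0 C1 MC l1 f [cf Uf].
have sq : square_in M (fun x : R * R => C (f x.1, x.2)).
  split; last by move=> s t s01 t01; apply: MC => //; exact: Uf.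
  by apply: continuous_compose => //; apply: continuous_pair;
    [apply: continuous_compose => //|]; prove_continuous.
have l0 : lin F (fun t => C (f 0, t)) != 1 by apply/l1/Uf; lra.
have l1' : lin F (fun t => C (f 1, t)) != 1 by apply/l1/Uf; lra.
apply/esym/fixptP => //.
have := act_square (fixpt (fun t => C (f 1, t))) sq; rewrite /=.
rewrite (act_fixpt l1') => e.
have e0 : (fun s => C (f s, 0)) = f by apply/funext => s; rewrite C0.
have e1 : (fun s => C (f s, 1)) = f by apply/funext => s; rewrite C1.
by rewrite e0 e1 in e; rewrite -e.
Qed.

(** The square swept out by a path in [U] compares it with its final image in [V], where [psi] is
    flat; the two other sides are the tracks along which values are carried back. *)
Lemma flat_homotopy (U V : set E) (H : E * R -> E) psi : continuous H ->
  (forall z, H (z, 0) = z) ->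
  (forall z t, U z -> 0 <= t <= 1 -> M (H (z, t))) ->
  (forall z, U z -> V (H (z, 1))) -> flat V psi ->
  flat U (fun z => act (fun t => H (z, t)) (psi (H (z, 1)))).
Proof.
move=> cH H0 MH HV fl f [cf Uf].
have sq : square_in M (fun x : R * R => H (f x.1, x.2)).
  split; last by move=> s t s01 t01; apply: MH => //; exact: Uf.
  by apply: continuous_compose => //; apply: continuous_pair;
    [apply: continuous_compose => //|]; prove_continuous.
have := act_square (psi (H (f 1, 1))) sq; rewrite /=.
have e0 : (fun s => H (f s, 0)) = f by apply/funext => s; rewrite H0.
rewrite e0 => ->; congr (act _ _).
apply: (fl (fun s => H (f s, 1))); split.
  by apply: continuous_compose => //; apply: continuous_pair; [|]; prove_continuous.
by move=> t t01; apply: HV; exact: Uf.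
Qed.

End PathFunctor.

(** * The monodromy of a circle around real points *)

(** Half of the minimum makes the inequalities strict, and [d] covers the empty family. An index to
    be ignored is given the value 1 by the callers. *)
Lemma exists_below (R : realType) (I : finType) (c : I -> R) (d : R) :
  (forall i, 0 < c i) -> 0 < d -> exists e, [/\ 0 < e, e < d & forall i, e < c i].
Proof.
move=> c0 d0; pose e := \big[Order.min/d]_i c i.
have e0 : 0 < e by rewrite /e; elim/big_ind : _ => // x y x0 y0; rewrite lt_min x0.
have ed : e <= d by exact: bigmin_le_id.
have ec i : e <= c i by exact: bigmin_le_cond.
exists (e / 2); split; first lra.
- lra.
- by move=> i; have := ec i; lra.
Qed.

Lemma convex_gt0 (R : realType) (s P Q : R) : 0 <= s <= 1 -> 0 < P -> 0 < Q ->
  0 < (1 - s) * P + s * Q.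
Proof. by move=> /andP[s0 s1] P0 Q0; have [h|h] := leP P Q; nra. Qed.

Section LinHomotopy.
Variables (R : realType).
Notation E := (CC R * CC R)%type.
Variables (M : set E) (F : affine_system M).

Lemma linE f : lin F f = act F f 1 - act F f 0.
Proof. by rewrite /act; ring. Qed.

Lemma lin_subpath f a b c : path_in M f ->
  0 <= a <= 1 -> 0 <= b <= 1 -> 0 <= c <= 1 ->
  lin F (subpath f a c) = lin F (subpath f a b) * lin F (subpath f b c).
Proof.
move=> Mf a01 b01 c01; rewrite linE.
by rewrite -(act_subpath F 1 Mf a01 b01 c01) -(act_subpath F 0 Mf a01 b01 c01) /act; ring.
Qed.

Lemma act_homotopy h z0 z1 w : square_in M h ->
  (forall s, h (s, 0) = z0) -> (forall s, h (s, 1) = z1) ->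
  act F (fun t => h (0, t)) w = act F (fun t => h (1, t)) w.
Proof.
move=> sq h0 h1; have [_ Mh] := sq.
have := act_square F w sq; under eq_fun do rewrite h0.
under [fun s => h (s, 1)]eq_fun do rewrite h1.
by rewrite !act_cst // -1?(h0 0) -?(h1 0); apply: Mh; lra.
Qed.

Lemma lin_homotopy h z0 z1 : square_in M h ->
  (forall s, h (s, 0) = z0) -> (forall s, h (s, 1) = z1) ->
  lin F (fun t => h (0, t)) = lin F (fun t => h (1, t)).
Proof. by move=> sq h0 h1; rewrite !linE !(act_homotopy _ sq h0 h1). Qed.

End LinHomotopy.

Lemma Im_RtoCD (R : realType) (a b : R) : complex.Im (RtoC a + CCi R * RtoC b : R[i]) = b.
Proof. by rewrite /=; ring. Qed.
Lemma Re_RtoCD (R : realType) (a b : R) : complex.Re (RtoC a + CCi R * RtoC b : R[i]) = a.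
Proof. by rewrite /=; ring. Qed.

Section CircleProduct.
Variables (R : realType).
Notation E := (CC R * CC R)%type.
Variables (M : set E) (F : affine_system M) (n : nat) (h : 'I_n -> R) (emb : CC R -> E).
Variable rho : 'I_n -> CC R.
Hypothesis h_inj : injective h.
Hypothesis emb_cont : continuous emb.
Hypothesis emb_in : forall y, (forall i, y != RtoC (h i)) -> M (emb y).
Hypothesis small_circle : forall i (r : R), 0 < r -> (forall j, j != i -> r < `|h j - h i|) ->
  lin F (fun t => emb (RtoC (h i) + unit_circle t * RtoC r)) = rho i.

Let off a := forall i, h i != a.

(* The constants k = 1 and k = -1 give arcs in the closed upper and lower half
   planes, meeting the real axis in a and b only. *)
Definition arc (k a b t : R) : CC R := RtoC (a + t * (b - a)) + CCi R * RtoC (k * (t * (1 - t))).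

Let arc_lin k a b := lin F (fun t => emb (arc k a b t)).

Lemma offreal (x y : R) : (y != 0 \/ off x) -> forall i, RtoC x + CCi R * RtoC y != RtoC (h i).
Proof.
move=> H i; apply/eqP => e.
have y0 : y = 0 by rewrite -(Im_RtoCD x y) e.
have xh : x = h i by rewrite -(Re_RtoCD x y) e.
by case: H => [/eqP //|/(_ i)]; rewrite xh eqxx.
Qed.

(** The quadratic form uv + vw + uw in barycentric coordinates restricts to t(1 - t) on each edge,
    so the three arcs bound a triangle on one side of the real axis. *)
Lemma arc_lin_triangle (k a b c : R) : k != 0 -> off a -> off b -> off c ->
  arc_lin k a c = arc_lin k a b * arc_lin k b c.
Proof.
move=> k0 oa ob oc.
(* The imaginary part vanishes at the vertices of the triangle only. *)
pose G (x : R * R * R) := emb (RtoC (x.1.1 * a + x.1.2 * b + x.2 * c) +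
   CCi R * RtoC (k * (x.1.1 * x.1.2 + x.1.2 * x.2 + x.1.1 * x.2))).
have MG : triangle_in M G.
  split; first by apply: continuous_compose => //; prove_continuous.
  move=> u v w u0 v0 w0 uvw; apply: emb_in; apply: offreal => /=.
  have [e|e] := eqVneq (u * v + v * w + u * w) 0; last by left; rewrite mulf_neq0.
  right.
  have uv : u * v = 0 by nra.
  have vw : v * w = 0 by nra.
  have uw : u * w = 0 by nra.
  move/eqP: uv; rewrite mulf_eq0 => /orP[/eqP u00|/eqP v00].
    move/eqP: vw; rewrite mulf_eq0 => /orP[/eqP v00|/eqP w00].
      have w1 : w = 1 by lra.
      by rewrite u00 v00 w1 !mul0r !add0r mul1r.
    have v1 : v = 1 by lra.
    by rewrite u00 w00 v1 !mul0r !add0r addr0 mul1r.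
  move/eqP: uw; rewrite mulf_eq0 => /orP[/eqP u00|/eqP w00].
    have w1 : w = 1 by lra.
    by rewrite u00 v00 w1 !mul0r !add0r mul1r.
  have u1 : u = 1 by lra.
  by rewrite v00 w00 u1 !mul0r !addr0 mul1r.
rewrite /arc_lin; have := lin_triangle F MG; rewrite /edge01 /edge12 /edge02 /G /=.
have E1 x y : (fun t => emb (arc k x y t)) = (fun t =>
    emb (RtoC ((1 - t) * x + t * y) + CCi R * RtoC (k * ((1 - t) * t)))).
  by apply/funext => t; rewrite /arc; congr (emb (RtoC _ + _ * RtoC _)); ring.
rewrite !E1 => e.
under eq_fun => t do (have -> : (1 - t) * a + t * c = (1 - t) * a + 0 * b + t * c by ring);
under eq_fun => t do (have -> : (1 - t) * t = (1 - t) * 0 + 0 * t + (1 - t) * t by ring).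
rewrite e; congr (lin F _ * lin F _); apply/funext => t; congr (emb (RtoC _ + _ * RtoC _)); ring.
Qed.

Lemma arc_linC (k a b : R) : k != 0 -> off a -> off b -> arc_lin k a b * arc_lin k b a = 1.
Proof.
move=> k0 oa ob; rewrite -arc_lin_triangle //.
apply: (mulfI (lin_neq0 F (fun t => emb (arc k a a t)))).
by rewrite -(arc_lin_triangle k0 oa oa oa) mulr1.
Qed.

(* Transport along the loop based at a that encloses the segment [a, b]
   counterclockwise; being a scalar, it does not depend on the base point. *)
Let mu a b := arc_lin (-1) a b * arc_lin 1 b a.

(** The loop around [a, c] runs along the lower arc to b, around [b, c], and back along the upper
    arc; the factors are scalars and commute. *)
Lemma mu_trans (a b c : R) : off a -> off b -> off c -> mu a c = mu a b * mu b c.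
Proof.
move=> oa ob oc; rewrite /mu (@arc_lin_triangle _ a b c) ?oppr_eq0 ?oner_eq0 //.
by rewrite (@arc_lin_triangle _ c b a) ?oner_eq0 //; ring.
Qed.

(** The lower arc is deformed into the upper one by letting the constant k run from -1 to 1; the
    arcs sweep over [a, b] only at real points of that segment, where no [h i] lies. *)
Lemma mu_empty (a b : R) : a <= b -> (forall i, h i < a \/ b < h i) -> mu a b = 1.
Proof.
move=> ab out.
have oa : off a by move=> i; apply/eqP; case: (out i); lra.
have ob : off b by move=> i; apply/eqP; case: (out i); lra.
rewrite /mu; suff -> : arc_lin (-1) a b = arc_lin 1 a b by rewrite arc_linC ?oner_eq0.
pose H (x : R * R) := emb (arc (2 * x.1 - 1) a b x.2).
have sq : square_in M H.
  split; first by apply: continuous_compose => //; rewrite /arc; prove_continuous.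
  move=> s t s01 t01; apply: emb_in; apply: offreal; right => i /=.
  by apply/eqP; case: (out i); nra.
have := @lin_homotopy _ _ F H (emb (RtoC a)) (emb (RtoC b)) sq.
rewrite /H /= mulr0 sub0r mulr1 => e.
have e2 : 2 - 1 = 1 :> R by lra.
rewrite /arc_lin e ?e2 // => s; congr emb; rewrite /arc.
  by rewrite !mul0r mulr0 RtoC0 mulr0 !addr0.
by rewrite subrr !mulr0 addr0 mul1r addrC subrK.
Qed.

Lemma sin_pi_gt0 (t : R) : 0 < t -> t < 1 -> 0 < sin (pi * t).
Proof.
by move=> t0 t1; apply: sin_gt0_pi; have := pi_gt0 R; nra.
Qed.

(** The circle is cut at its real points c + r (t = 0) and c - r (t = 1/2). Each half is
    interpolated linearly with the parabolic arc on the same side of the axis: both imaginary parts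
    have the same sign, so the real axis is met only at the end points. *)
Lemma circle_mu (c r : R) : 0 < r -> (forall i, `|h i - c| != r) ->
  lin F (fun t => emb (RtoC c + unit_circle t * RtoC r)) = mu (c - r) (c + r).
Proof.
move=> r0 ne.
have om : off (c - r).
  move=> i; apply: contra_neq (ne i) => ->.
  by rewrite addrAC subrr add0r normrN gtr0_norm.
have op : off (c + r).
  move=> i; apply: contra_neq (ne i) => ->.
  by rewrite addrAC subrr add0r gtr0_norm.
set f := fun t => _.
have Eu t : RtoC c + unit_circle t * RtoC r =
    RtoC (c + r * cos (2 * pi * t)) + CCi R * RtoC (r * sin (2 * pi * t)).
  rewrite [unit_circle t]CC_decomp /= !RtoCD !RtoCM; ring.
have cf : continuous f by apply: continuous_compose => //; prove_continuous.
have unit_half (t : R) : 2 * pi * (0 + t * (2^-1 - 0)) = pi * t by field.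
have unit_half' (t : R) : 2 * pi * (2^-1 + t * (1 - 2^-1)) = pi * t + pi by field.
have Mf : path_in M f.
  split=> // t t01; apply: emb_in => i; rewrite Eu; apply: offreal.
  have [e|] := eqVneq (r * sin (2 * pi * t)) 0; last by left.
  right; have s0 : sin (2 * pi * t) = 0.
    by move/eqP: e; rewrite mulf_eq0 (gt_eqF r0) => /eqP.
  have := sin2cos2 (2 * pi * t); rewrite s0 expr0n /= => /esym/eqP.
  rewrite subr_eq0 eq_sym sqrf_eq1 => /orP[] /eqP ->; first by rewrite mulr1.
  by rewrite mulrN1.
have I0 : 0 <= (0 : R) <= 1 by lra.
have I1 : 0 <= (1 : R) <= 1 by lra.
have Ih : 0 <= (2^-1 : R) <= 1 by lra.
have -> : lin F f = lin F (subpath f 0 2^-1) * lin F (subpath f 2^-1 1).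
  by rewrite -(lin_subpath F Mf I0 Ih I1) subpath01.
(* The circle starts with its upper half and [mu] with the lower arc, hence the exchange of factors;
   the lower half is treated first. *)
rewrite /mu mulrC; congr (_ * _).
  pose H (x : R * R) := emb ((RtoC (1 - x.1)) * (RtoC c + unit_circle (2^-1 + x.2 * (1 - 2^-1)) * RtoC r)
     + RtoC x.1 * arc (-1) (c - r) (c + r) x.2).
  have sq : square_in M H.
    split; first by apply: continuous_compose => //; rewrite /arc; prove_continuous.
    move=> s t /= s01 t01; apply: emb_in; rewrite Eu unit_half' /arc sinDpi cosDpi.
    move=> i; set X := (X in X != _ ).
    have -> : X = RtoC ((1 - s) * (c + r * - cos (pi * t)) + s * (c - r + t * (c + r - (c - r))))
        + CCi R * RtoC ((1 - s) * (r * - sin (pi * t)) + s * (-1 * (t * (1 - t)))).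
      by rewrite /X !(RtoCD, RtoCM, RtoCB, RtoCN); ring.
    move: i; apply: offreal.
    have [->|t0] := eqVneq t 0.
      right; rewrite mulr0 cos0 mul0r.
      by have -> : (1 - s) * (c + r * - 1) + s * (c - r + 0) = c - r by ring.
    have [->|t1] := eqVneq t 1.
      right; rewrite mulr1 cospi.
      by have -> : (1 - s) * (c + r * - -1) + s * (c - r + 1 * (c + r - (c - r))) = c + r by ring.
    left; apply/eqP.
    have t0' : 0 < t by rewrite lt_neqAle eq_sym t0; lra.
    have t1' : t < 1 by rewrite lt_neqAle t1; lra.
    have sn := sin_pi_gt0 t0' t1'.
    have p1 : 0 < r * sin (pi * t) by rewrite mulr_gt0.
    have p2 : 0 < t * (1 - t) by rewrite mulr_gt0 // subr_gt0.
    by have := convex_gt0 s01 p1 p2; rewrite mulrN mulN1r; lra.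
  have := @lin_homotopy _ _ F H (emb (RtoC (c - r))) (emb (RtoC (c + r))) sq.
  rewrite /H /= => e.
  transitivity (lin F (fun t => emb
    (RtoC (1 - 0) * (RtoC c + unit_circle (2^-1 + t * (1 - 2^-1)) * RtoC r) +
     RtoC 0 * arc (-1) (c - r) (c + r) t))).
    by congr (lin F _); apply/funext => t; rewrite /subpath /f subr0 RtoC1 RtoC0 mul1r mul0r addr0.
  rewrite e; first by congr (lin F _); apply/funext => t; rewrite subrr RtoC1 RtoC0 mul1r mul0r add0r.
    move=> s; congr emb; rewrite Eu unit_half' mulr0 add0r cospi sinpi /arc.
    by rewrite !(RtoCD, RtoCM, RtoCB, RtoCN, RtoC0, RtoC1); ring.
  move=> s; congr emb; rewrite Eu unit_half' mulr1 cosDpi sinDpi cospi sinpi /arc.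
  by rewrite !(RtoCD, RtoCM, RtoCB, RtoCN, RtoC0, RtoC1); ring.
pose H (x : R * R) := emb ((RtoC (1 - x.1)) * (RtoC c + unit_circle (0 + x.2 * (2^-1 - 0)) * RtoC r)
     + RtoC x.1 * arc 1 (c + r) (c - r) x.2).
have sq : square_in M H.
  split; first by apply: continuous_compose => //; rewrite /arc; prove_continuous.
  move=> s t /= s01 t01; apply: emb_in; rewrite Eu unit_half /arc.
  move=> i; set X := (X in X != _ ).
  have -> : X = RtoC ((1 - s) * (c + r * cos (pi * t)) + s * (c + r + t * (c - r - (c + r))))
        + CCi R * RtoC ((1 - s) * (r * sin (pi * t)) + s * (1 * (t * (1 - t)))).
    by rewrite /X !(RtoCD, RtoCM, RtoCB, RtoCN); ring.
  move: i; apply: offreal.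
  have [->|t0] := eqVneq t 0.
    right; rewrite mulr0 cos0 mul0r.
    by have -> : (1 - s) * (c + r * 1) + s * (c + r + 0) = c + r by ring.
  have [->|t1] := eqVneq t 1.
    right; rewrite mulr1 cospi.
    by have -> : (1 - s) * (c + r * -1) + s * (c + r + 1 * (c - r - (c + r))) = c - r by ring.
  left; apply/eqP.
  have t0' : 0 < t by rewrite lt_neqAle eq_sym t0; lra.
  have t1' : t < 1 by rewrite lt_neqAle t1; lra.
  have sn := sin_pi_gt0 t0' t1'.
  have p1 : 0 < r * sin (pi * t) by rewrite mulr_gt0.
  have p2 : 0 < t * (1 - t) by rewrite mulr_gt0 // subr_gt0.
  by have := convex_gt0 s01 p1 p2; rewrite mul1r; lra.
have := @lin_homotopy _ _ F H (emb (RtoC (c + r))) (emb (RtoC (c - r))) sq.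
rewrite /H /= => e.
transitivity (lin F (fun t => emb
    (RtoC (1 - 0) * (RtoC c + unit_circle (0 + t * (2^-1 - 0)) * RtoC r) +
     RtoC 0 * arc 1 (c + r) (c - r) t))).
  by congr (lin F _); apply/funext => t; rewrite /subpath /f [1 - 0]subr0 RtoC1 RtoC0 mul1r mul0r addr0.
rewrite e; first by congr (lin F _); apply/funext => t; rewrite subrr RtoC1 RtoC0 mul1r mul0r add0r.
  move=> s; congr emb; rewrite Eu unit_half mulr0 cos0 sin0 /arc.
  by rewrite !(RtoCD, RtoCM, RtoCB, RtoCN, RtoC0, RtoC1); ring.
move=> s; congr emb; rewrite Eu unit_half mulr1 cospi sinpi /arc.
by rewrite !(RtoCD, RtoCM, RtoCB, RtoCN, RtoC0, RtoC1); ring.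
Qed.

(** Induction on the number of enclosed points. Cutting at [h i0 - r] and [h i0 + r] isolates one of
    them in a small circle, and the two outer intervals enclose fewer points. *)
Lemma mu_prod (a b : R) : off a -> off b -> a <= b -> mu a b = \prod_(i | a < h i < b) rho i.
Proof.
move=> oa ob ab.
have [k] := ubnP #|[pred i | a < h i < b]|.
elim: k a b oa ob ab => // k IH a b oa ob ab ck.
case: (pickP [pred i | a < h i < b]) => [i0 /= /andP[ai0 i0b]|none]; last first.
  rewrite big_pred0 // mu_empty // => i.
  have /= := none i; have := oa i; have := ob i.
  rewrite !neq_lt => /orP[] ? /orP[] ?; try (by left); try (by right); lra.
have c0 j : 0 < (if j == i0 then 1 else `|h j - h i0|).
  case: eqP => // /eqP ji; rewrite normr_gt0 subr_eq0.
  by apply: contra_neq ji => /h_inj.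
have d0 : 0 < Num.min (h i0 - a) (b - h i0) by rewrite lt_min !subr_gt0 ai0.
have [r [r0 rd rj]] := exists_below c0 d0.
have {}rj j : j != i0 -> r < `|h j - h i0| by move=> ji; have := rj j; rewrite (negbTE ji).
move: rd; rewrite lt_min => /andP[ra rb].
have ne i : `|h i - h i0| != r.
  have [->|/rj] := eqVneq i i0; first by rewrite subrr normr0 lt_eqF.
  by move=> ?; rewrite gt_eqF.
have om : off (h i0 - r).
  move=> i; apply: contra_neq (ne i) => ->.
  by rewrite addrAC subrr add0r normrN gtr0_norm.
have op : off (h i0 + r).
  move=> i; apply: contra_neq (ne i) => ->.
  by rewrite addrAC subrr add0r gtr0_norm.
have le1 : a <= h i0 - r by lra.
have le2 : h i0 + r <= b by lra.
have card1 : (#|[pred i | (a < h i < h i0 - r)%R]| < k)%N.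
  rewrite -ltnS; apply: leq_trans ck; rewrite ltnS; apply: proper_card; apply/properP; split.
    by apply/fintype.subsetP => i; rewrite !inE; lra.
  by exists i0; rewrite !inE; lra.
have card2 : (#|[pred i | (h i0 + r < h i < b)%R]| < k)%N.
  rewrite -ltnS; apply: leq_trans ck; rewrite ltnS; apply: proper_card; apply/properP; split.
    by apply/fintype.subsetP => i; rewrite !inE; lra.
  by exists i0; rewrite !inE; lra.
rewrite (mu_trans oa om ob) (mu_trans om op ob) -circle_mu // small_circle //.
rewrite (IH _ _ oa om le1 card1) (IH _ _ op ob le2 card2).
rewrite mulrCA [RHS](bigD1 i0) /= ?ai0 //; congr (_ * _).
rewrite [RHS](bigID (fun i => h i < h i0)) /=; congr (_ * _).
  apply: eq_bigl => i; have [->|/rj] := eqVneq i i0; first by rewrite !ltxx !andbF; lra.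
  rewrite ltr_normr => /orP[] ?; apply/idP/idP; lra.
apply: eq_bigl => i; have [->|/rj] := eqVneq i i0; first by rewrite !ltxx !andbF; lra.
rewrite ltr_normr => /orP[] ?; apply/idP/idP; lra.
Qed.

Lemma circle_prod (c r : R) : 0 < r -> (forall i, `|h i - c| != r) ->
  lin F (fun t => emb (RtoC c + unit_circle t * RtoC r)) = \prod_(i | `|h i - c| < r) rho i.
Proof.
move=> r0 ne; rewrite circle_mu // mu_prod; last by lra.
- by apply: eq_bigl => i; rewrite ltr_norml; apply/idP/idP; lra.
- move=> i; apply: contra_neq (ne i) => ->.
  by rewrite addrAC subrr add0r normrN gtr0_norm.
- move=> i; apply: contra_neq (ne i) => ->.
  by rewrite addrAC subrr add0r gtr0_norm.
Qed.

End CircleProduct.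

(** * Flat sections and the projection *)

(** In the affine coordinate w with value 0 at y and 1 at y', the arcs are the parabolas Im w = k Re
    w (1 - Re w). Off its end points, such an arc can pass through [c j] only if k is the number
    [q j], so a positive k below all positive [q j] works. The bound [k0] controls how far the arc
    bulges. *)
Lemma avoid_arc (R : realType) (J : finType) (c : J -> CC R) (y y' : CC R) (k0 : R) :
  0 < k0 -> (forall j, y != c j) -> (forall j, y' != c j) ->
  exists k, [/\ 0 < k, k < k0 & forall t j,
    y + (RtoC t + CCi R * RtoC (k * (t * (1 - t)))) * (y' - y) != c j].
Proof.
move=> k00 yc y'c; have [e|ne] := eqVneq y' y.
  exists (k0 / 2); split; [lra|lra|] => t j.
  by rewrite e subrr mulr0 addr0.
have ne' : y' - y != 0 by rewrite subr_eq0.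
pose w j := (c j - y) / (y' - y).
pose a j := complex.Re (w j : R[i]).
pose q j := complex.Im (w j : R[i]) / (a j * (1 - a j)).
have e0 j : 0 < if 0 < q j then q j else 1 by case: ifP.
have [k [kp kk0 kq]] := exists_below e0 k00.
exists k; split=> // t j; apply/eqP => e.
have wE : w j = RtoC t + CCi R * RtoC (k * (t * (1 - t))).
  by rewrite /w -e addrAC subrr add0r mulfK.
have at_ : a j = t by rewrite /a wE Re_RtoCD.
have t0 : t != 0.
  by apply: contra_neq (yc j) => t0; rewrite -e t0 !RtoCM RtoC0; ring.
have t1 : t != 1.
  by apply: contra_neq (y'c j) => t1; rewrite -e t1 subrr !RtoCM RtoC0 RtoC1; ring.
have tt : t * (1 - t) != 0 by rewrite mulf_neq0 // subr_eq0 eq_sym.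
have qk : q j = k by rewrite /q at_ wE Im_RtoCD mulfK.
by have := kq j; rewrite qk kp ltxx.
Qed.

Lemma exists_above (R : realType) (n : nat) (c : 'I_n -> R) :
  exists2 K, 1 <= K & forall i, `|c i| <= K.
Proof.
exists (1 + \sum_i `|c i|); first by rewrite lerDl sumr_ge0.
move=> i; rewrite (bigD1 i) //=.
have : 0 <= \sum_(j < n | j != i) `|c j| by rewrite sumr_ge0.
by lra.
Qed.

Section NbhsSnd.
Variable R : realType.
Implicit Types (z : CC R * CC R) (r : R).

Let nbhs_snd z r : 0 < r -> \forall z' \near z, cabs (z'.2 - z.2) < r.
Proof.
by move=> r0; apply: (@nbhs_cabs _ _ (fun z : CC R * CC R => z.2)) => //; prove_continuous.
Qed.

Lemma nbhs_snd_lt (c : CC R) z r : cabs (z.2 - c) < r -> \forall z' \near z, cabs (z'.2 - c) < r.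
Proof.
rewrite -subr_gt0 => /(@nbhs_snd z); apply: filterS => z' hz'.
have -> : z'.2 - c = (z'.2 - z.2) + (z.2 - c) by ring.
by apply: le_lt_trans (cabsD _ _) _; lra.
Qed.

Lemma nbhs_snd_gt (I : finType) (c : I -> CC R) z r : (forall i, r < cabs (z.2 - c i)) ->
  \forall z' \near z, forall i, r < cabs (z'.2 - c i).
Proof.
move=> hz; have c0 i : 0 < cabs (z.2 - c i) - r by rewrite subr_gt0.
have [e [e0 _ ec]] := exists_below c0 ltr01.
apply: filterS (nbhs_snd z e0) => z' hz' i; have := ec i.
have -> : z.2 - c i = - (z'.2 - z.2) + (z'.2 - c i) by ring.
by have := cabsD (- (z'.2 - z.2)) (z'.2 - c i); rewrite cabsN; lra.
Qed.

End NbhsSnd.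

Section Fibration.
Variables (R : realType) (n m : nat) (sl ic : 'I_n -> R) (xi : 'I_m -> R).
Notation E := (CC R * CC R)%type.
Variables (M : set E) (F : affine_system M).

Definition height (i : 'I_n) (x : CC R) : CC R := RtoC (sl i) * x + RtoC (ic i).
Definition base (x : CC R) := forall j, x != RtoC (xi j).

Hypothesis ME : forall x y, M (x, y) <-> base x /\ forall i, y != height i x.
Hypothesis crossing : forall i j x, base x -> i != j -> height i x != height j x.

Definition fibre (b : CC R) : set E := [set z | M z /\ z.1 = b].
Definition tube (b : CC R) (e : R) : set E := [set z | M z /\ cabs (z.1 - b) < e].

Lemma heightB i x x' : height i x - height i x' = RtoC (sl i) * (x - x').
Proof. by rewrite /height; ring. Qed.

Lemma fibre_base b z : fibre b z -> base b.
Proof. by case: z => x y [/ME[bx _] /= <-]. Qed.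

(** * Extension of a flat section from a fibre to a tube *)

Section LocalTriviality.
Variables (b b' : CC R) (K d e : R).
Hypotheses (bb : forall x, cabs (x - b) < e -> base x) (K1 : 1 <= K)
  (Ksl : forall i, `|sl i| <= K) (e0 : 0 < e) (ed : 16 * K * e < d)
  (sep : forall i j, i != j -> d < cabs (height i b - height j b))
  (b'b : cabs (b' - b) < e).

(* Slide z into the fibre over b' along a line of slope s: slope 0 away from the
   lines of the arrangement, the slope of the i-th line close to that line. *)
Let H (s : CC R) (zt : E * R) : E :=
  (zt.1.1 + RtoC zt.2 * (b' - zt.1.1), zt.1.2 + RtoC zt.2 * (s * (b' - zt.1.1))).

Let H_cont s : continuous (H s).
Proof. by rewrite /H; prove_continuous. Qed.

Let H0 s z : H s (z, 0) = z.
Proof. by case: z => x y; rewrite /H /= RtoC0 !mul0r !addr0. Qed.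

Let H1 s z : (H s (z, 1)).1 = b'.
Proof. by rewrite /H /= mul1r addrC subrK. Qed.

Let close x (t : R) : cabs (x - b) < e -> 0 <= t <= 1 -> cabs (x + RtoC t * (b' - x) - b) < e.
Proof.
move=> xb t01; have /andP[t0 t1] := t01.
have -> : x + RtoC t * (b' - x) - b = RtoC (1 - t) * (x - b) + RtoC t * (b' - b).
  by rewrite RtoCB RtoC1; ring.
apply: le_lt_trans (cabsD _ _) _; rewrite !cabsM !cabs_RtoC !ger0_norm; [|lra..].
have p : 0 < e - cabs (x - b) by rewrite subr_gt0.
have q : 0 < e - cabs (b' - b) by rewrite subr_gt0.
by have := convex_gt0 t01 p q; lra.
Qed.

Let height_close i x : cabs (x - b) < e -> cabs (height i x - height i b) < K * e.
Proof.
move=> xb; rewrite heightB cabsM cabs_RtoC.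
apply: le_lt_trans (ler_wpM2r (cabs_ge0 _) (Ksl i)) _.
by rewrite ltr_pM2l //; have := K1; lra.
Qed.

Let shift_close i x (t : R) : cabs (x - b) < e -> 0 <= t <= 1 ->
  cabs (RtoC t * (RtoC (sl i) * (b' - x))) <= 2 * K * e.
Proof.
move=> xb t01; rewrite !cabsM !cabs_RtoC ger0_norm; last by lra.
have h : cabs (b' - x) < e + e by apply: cabs_lt_dist b'b _; rewrite cabsB.
have h0 := cabs_ge0 (b' - x); have k0 := Ksl i; have k1 := normr_ge0 (sl i).
have p : `|sl i| * cabs (b' - x) <= K * (e + e) by apply: ler_pM => //; exact: ltW.
have p0 : 0 <= `|sl i| * cabs (b' - x) by apply: mulr_ge0.
by move/andP: t01 => [t0 t1]; nra.
Qed.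

(** Over the disc of radius e each line stays within K e of its height over b, and a slide moves a
    point by at most 2 K e. Hence 3 K e: a point farther than this from the i-th height misses the
    i-th line for every intermediate slope. The bound 4 K e makes the regions overlap, and two
    different near regions are disjoint since 8 K e < d. *)
Let region (a : option 'I_n) : set E :=
  if a is Some i then [set z | cabs (z.2 - height i b) < 4 * K * e]
  else [set z | forall i, 3 * K * e < cabs (z.2 - height i b)].

Let slope (a : option 'I_n) : CC R := if a is Some i then RtoC (sl i) else 0.

Let Ke0 : 0 < K * e. Proof. by apply: mulr_gt0 => //; have := K1; lra. Qed.

Let off_far i j x y w : cabs (x - b) < e -> i != j ->
  cabs (y - height j b) < 4 * K * e -> cabs w <= 2 * K * e -> y + w != height i x.
Proof.
move=> xb ij yj wb; apply/eqP => eq_; have := sep ij.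
have -> : height i b - height j b = - (height i x - height i b) + (y - height j b) + w.
  by rewrite -eq_; ring.
move=> h; have := height_close i xb; have := cabsD (- (height i x - height i b) + (y - height j b)) w.
have := cabsD (- (height i x - height i b)) (y - height j b); rewrite cabsN.
by have := ed; have := Ke0; lra.
Qed.

Let H_in a z (t : R) : tube b e z -> region a z -> 0 <= t <= 1 -> M (H (slope a) (z, t)).
Proof.
case: z => x y [Mxy /= xb] Oz t01; apply/ME; split; first by apply: bb; exact: close.
move=> i; case: a Oz => [j|] /= Oz.
  have [ij|ij] := eqVneq i j.
    have /ME[_ /(_ j)] := Mxy; apply: contra_neq; rewrite ij /height => h.
    by apply: (addIr (RtoC t * (RtoC (sl j) * (b' - x)))); rewrite h; ring.
  by apply: off_far Oz _ => //; [exact: close|exact: shift_close].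
rewrite mul0r mulr0 addr0; apply/eqP => h.
by have := Oz i; have := height_close i (close xb t01); have := Ke0; rewrite -h; lra.
Qed.

Let sect psi a z := act F (fun t => H (slope a) (z, t)) (psi (H (slope a) (z, 1))).

(** The slope is scaled from 0 to [sl j] by a parameter s. All slides start at z, and their end
    points trace a path in the fibre over b', along which [psi] is flat. *)
Let sect_agree psi j z : flat F (fibre b') psi -> tube b e z ->
  region None z -> region (Some j) z -> sect psi None z = sect psi (Some j) z.
Proof.
case: z => x y fl Tz; have [Mxy /= xb] := Tz => Oz Ozj.
pose h (st : R * R) := H (RtoC st.1 * RtoC (sl j)) ((x, y), st.2).
have sq : square_in M h.
  split; first by rewrite /h /H; prove_continuous.
  move=> s t s01 t01.
  apply/ME => /=; split; first by apply: bb; exact: close.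
  have sb : cabs (RtoC t * (RtoC s * RtoC (sl j) * (b' - x))) <= 2 * K * e.
    have -> : RtoC t * (RtoC s * RtoC (sl j) * (b' - x)) = RtoC (t * s) * (RtoC (sl j) * (b' - x)).
      by rewrite RtoCM; ring.
    by apply: shift_close => //; nra.
  move=> i; have [ij|ij] := eqVneq i j; last by apply: off_far Ozj sb => //; exact: close.
  apply/eqP => q; have := Oz j; have := height_close j (close xb t01).
  set w := RtoC t * (_ * _ * _) in q sb.
  have -> : y - height j b = (height j (x + RtoC t * (b' - x)) - height j b) + - w.
    by rewrite -[in height j (_ + _)]ij -q; ring.
  move=> h1 h2; have := cabsD (height j (x + RtoC t * (b' - x)) - height j b) (- w).
  by rewrite cabsN; have := Ke0; lra.
have := act_square F (psi (h (1, 1))) sq.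
have -> : (fun s => h (s, 0)) = fun=> (x, y) by apply/funext => s; rewrite /h /= H0.
rewrite act_cst // -(fl (fun s => h (s, 1))) /= => [q|].
  transitivity (act F (fun t => h (0, t)) (psi (h (0, 1)))).
    by congr (act _ _ _); [apply/funext => t|congr psi]; rewrite /h /= RtoC0 mul0r.
  by rewrite -q; congr (act _ _ _); [apply/funext => t|congr psi]; rewrite /h /= RtoC1 mul1r.
split; first by rewrite /h /H; prove_continuous.
move=> s s01; split; first by apply: (proj2 sq) => //; lra.
by rewrite /h H1.
Qed.

Lemma flat_tube psi : flat F (fibre b') psi -> exists psi', flat F (tube b e) psi'.
Proof.
move=> fl; apply: (@flat_glue _ _ F (option 'I_n) (fun a => tube b e `&` region a) region (sect psi)).
- by move=> z [].
- move=> z _; have [[i hi]|nx] := pselect (exists i, cabs (z.2 - height i b) < 4 * K * e).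
    by exists (Some i).
  exists None => i /=; rewrite ltNge; apply/negP => h; apply: nx; exists i.
  by have := Ke0; lra.
- by case=> [i|] z /=; [exact: nbhs_snd_lt|exact: nbhs_snd_gt].
- by move=> a z.
- move=> a; apply: (@flat_homotopy _ _ F _ (fibre b') (H (slope a)) psi (@H_cont _) (@H0 _)) => //.
    by move=> z t [? ?]; apply: H_in.
  move=> z [Tz Oz]; split; last exact: H1.
  by apply: H_in => //; lra.
- case=> [i|] [j|] z Tz Oi Oj //.
  + have [->//|ij] := eqVneq i j; exfalso; have := sep ij.
    have Oi' : cabs (height i b - z.2) < 4 * K * e by rewrite cabsB.
    have := cabs_lt_dist Oi' Oj.
    by have := ed; have := Ke0; lra.
  + by apply/esym; apply: sect_agree.
  + by apply: sect_agree.
Qed.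

End LocalTriviality.

(** The starting fibre is any fibre over the disc and not just the one over b, so that sections can
    be passed between any two nearby fibres, as [real_induction] demands. *)
Lemma local_triviality b : base b -> exists e, [/\ 0 < e, (forall x, cabs (x - b) < e -> base x) &
  forall b' psi, cabs (b' - b) < e -> flat F (fibre b') psi -> exists psi', flat F (tube b e) psi'].
Proof.
move=> bb; have [K K1 Ksl] := exists_above sl.
have c0 (ij : 'I_n * 'I_n) :
    0 < if ij.1 == ij.2 then 1 else cabs (height ij.1 b - height ij.2 b).
  case: ifPn => // ne; apply: cabs_gt0; rewrite subr_eq0.
  exact: crossing.
have [d [d0 _ dc]] := exists_below c0 ltr01.
have x0 j : 0 < cabs (b - RtoC (xi j)) by apply: cabs_gt0; rewrite subr_eq0.
have K16 : 0 < 16 * K by lra.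
have dK : 0 < d / (16 * K) by rewrite divr_gt0.
have [e [e0 eK ex]] := exists_below x0 dK.
have be x : cabs (x - b) < e -> base x.
  move=> xb j; apply: contraTneq (ex j) => xj; rewrite -leNgt -xj cabsB; exact: ltW.
have ed : 16 * K * e < d by rewrite mulrC -ltr_pdivlMr.
have sep i j : i != j -> d < cabs (height i b - height j b).
  by move=> ij; have := dc (i, j); rewrite /= (negbTE ij).
exists e; split=> // b' psi b'b fl.
exact: (flat_tube be K1 Ksl e0 ed sep b'b fl).
Qed.

(** A parabolic arc joins x to b in the base and misses the abscissas of the vertical lines; the
    mere existence of a flat section is propagated along it. *)
Lemma flat_propagate x b : base x -> base b ->
  (exists psi, flat F (fibre x) psi) -> exists psi, flat F (fibre b) psi.
Proof.
move=> bx bb ex; have [k [_ _ av]] := avoid_arc ltr01 bx bb.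
pose g (t : R) := x + (RtoC t + CCi R * RtoC (k * (t * (1 - t)))) * (b - x).
have cg : continuous g by rewrite /g; prove_continuous.
have g1 : g 1 = b by rewrite /g subrr !RtoCM RtoC0 RtoC1; ring.
pose P t := exists psi, flat F (fibre (g t)) psi.
suff : P 1 by rewrite /P g1.
apply: real_induction.
  by rewrite /P; have -> : g 0 = x by rewrite /g !RtoCM RtoC0; ring.
move=> t t01; have [e [e0 be tr]] := local_triviality (av t).
have /nbhs_ballP[r /= r0 near_t] := nbhs_cabs t cg e0.
exists r => // s s' s01 s'01; rewrite distrC => ss; rewrite distrC => ss' [psi fl].
have [psi' fl'] := tr _ _ (near_t s ss) fl; exists psi'.
apply: flat_sub fl' => z [Mz zs]; split => //; rewrite zs; exact: near_t s' ss'.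
Qed.

(** * Uniqueness on a fibre and the global flat section *)

Section Uniqueness.
Variables (i0 : 'I_n) (rho0 : CC R).
Hypothesis rho0_neq1 : rho0 != 1.
Hypothesis meridian : forall x (r : R), base x -> 0 < r ->
  (forall j, j != i0 -> r < cabs (height j x - height i0 x)) ->
  lin F (fun t => (x, height i0 x + unit_circle t * RtoC r)) = rho0.

(** On a small circle around line [i0] a flat section is fixed by a loop with linear part different
    from 1, which determines its value at the starting point. An arc in the fibre carries this to
    every other point. *)
Lemma flat_unique b psi psi' : flat F (fibre b) psi -> flat F (fibre b) psi' ->
  forall z, fibre b z -> psi z = psi' z.
Proof.
move=> fl fl' [x y] Fz; have bb := fibre_base Fz; have [Mz /= xb] := Fz; subst x.
have c0 j : 0 < if j == i0 then 1 else cabs (height j b - height i0 b).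
  by case: ifPn => // ji; apply: cabs_gt0; rewrite subr_eq0; exact: crossing.
have [r [r0 _ rc]] := exists_below c0 ltr01.
have {}rc j : j != i0 -> r < cabs (height j b - height i0 b).
  by move=> ji; have := rc j; rewrite (negbTE ji).
have lr := meridian bb r0 rc.
have circ (t : R) j : height i0 b + unit_circle t * RtoC r != height j b.
  apply/eqP => q.
  have : cabs (height j b - height i0 b) = r.
    by rewrite -q addrAC subrr add0r cabsM cabs_unit mul1r cabs_RtoC gtr0_norm.
  have [->|/rc] := eqVneq j i0; first by rewrite subrr cabs0; move: r0; lra.
  by lra.
pose f t := (b, height i0 b + unit_circle t * RtoC r).
have ff : path_in (fibre b) f.
  split; first by rewrite /f; prove_continuous.
  by move=> t t01; split => //; apply/ME.
have same : psi (f 0) = psi' (f 0).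
  have l1 : lin F f != 1 by rewrite lr.
  have f1 : f 1 = f 0 by rewrite /f unit_circle0 unit_circle1.
  have := fl f ff; have := fl' f ff; rewrite f1 => /esym/fixptP -> // /esym/fixptP -> //.
have [k [_ _ av]] := avoid_arc ltr01 (proj2 (proj1 (ME b y) Mz)) (circ 0).
pose g (t : R) := (b, y + (RtoC t + CCi R * RtoC (k * (t * (1 - t)))) *
  (height i0 b + unit_circle 0 * RtoC r - y)).
have gg : path_in (fibre b) g.
  split; first by rewrite /g; prove_continuous.
  by move=> t t01; split => //; apply/ME.
have g0 : g 0 = (b, y) by rewrite /g; congr pair; rewrite !RtoCM RtoC0; ring.
have g1 : g 1 = f 0 by rewrite /g; congr pair; rewrite subrr !RtoCM RtoC0 RtoC1; ring.
by rewrite -g0 (fl g gg) (fl' g gg) g1 same.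
Qed.

(** The sections on the fibres are chosen independently of each other. By uniqueness they coincide
    with the extension to a tube around any given fibre, and flatness is a local property. *)
Lemma flat_global x : base x -> (exists psi, flat F (fibre x) psi) ->
  exists psi, flat F M psi.
Proof.
move=> bx ex.
have exb b : exists psi, base b -> flat F (fibre b) psi.
  have [bb|nb] := pselect (base b); last by exists (fun=> 0).
  by have [psi fl] := flat_propagate bx bb ex; exists psi.
have [psi fl] := choice exb.
exists (fun z => psi z.1 z); apply: flat_local => // -[b y] /ME[bb _].
have [e [e0 be tr]] := local_triviality bb.
have b_in : cabs (b - b) < e by rewrite subrr cabs0.
have [psi' fl'] := tr b (psi b) b_in (fl b bb).
exists [set z | cabs (z.1 - b) < e].
  by apply: (@nbhs_cabs _ _ (fun z : E => z.1) (b, y)) => //; prove_continuous.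
apply: (@flat_ext _ _ F _ psi'); last by apply: flat_sub fl' => z [].
move=> z [Mz zb]; apply: (@flat_unique z.1) => //.
  by apply: flat_sub fl' => z' [Mz' zz]; split => //; rewrite zz.
by apply: fl; exact: be.
Qed.

End Uniqueness.

End Fibration.

(** * The flat section near a vertical line *)

Section FreeHomotopy.
Variables (R : realType).
Notation E := (CC R * CC R)%type.
Variables (M : set E) (F : affine_system M).

(** The track of the base point occurs on both sides of the square relation and cancels, scalars
    being commutative. *)
Lemma lin_free_homotopy h : square_in M h -> (forall s, h (s, 0) = h (s, 1)) ->
  lin F (fun t => h (0, t)) = lin F (fun t => h (1, t)).
Proof.
move=> sq h01; have := lin_square F sq.
have -> : (fun s => h (s, 1)) = (fun s => h (s, 0)) by apply/funext => s; rewrite h01.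
by rewrite mulrC => /(mulIf (lin_neq0 _ _)) ->.
Qed.

Lemma lin_diagonal h : square_in M h ->
  lin F (fun t => h (t, t)) = lin F (fun t => h (t, 0)) * lin F (fun t => h (1, t)).
Proof.
move=> /square_triangles[/(lin_triangle F) + _]; rewrite /edge01 /edge12 /edge02 /=.
under [fun t : R => h (0 + t, t)]funext do rewrite add0r.
under [fun t : R => h (t + 0, 0)]funext do rewrite addr0.
by under [fun t : R => h (1 - t + t, t)]funext do rewrite subrK.
Qed.

End FreeHomotopy.

Section NearVertical.
Variables (R : realType) (n m : nat) (sl ic : 'I_n -> R) (xi : 'I_m -> R).
Notation E := (CC R * CC R)%type.
Variables (M : set E) (F : affine_system M).
Notation height := (height sl ic).
Notation base := (base xi).
Hypothesis ME : forall x y, M (x, y) <-> base x /\ forall i, y != height i x.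
Hypothesis crossing : forall i j x, base x -> i != j -> height i x != height j x.
Hypothesis xi_inj : injective xi.
Variables (rho : 'I_n -> CC R) (j0 : 'I_m) (rho0 : CC R).
Let p := RtoC (xi j0).
Hypothesis lin_hor : forall i x (r : R), base x -> 0 < r ->
  (forall j, j != i -> r < cabs (height j x - height i x)) ->
  lin F (fun t => (x, height i x + unit_circle t * RtoC r)) = rho i.
Hypothesis lin_ver : forall v1 v2 y : CC R, v1 != 0 ->
  (forall j, j != j0 -> cabs v1 < cabs (RtoC (xi j) - p)) ->
  (forall i z, cabs z <= 1 -> y + z * v2 != height i (p + z * v1)) ->
  lin F (fun t => (p + unit_circle t * v1, y + unit_circle t * v2)) = rho0.
Hypothesis rho0_neq1 : rho0 != 1.

Definition crossing_height (i : 'I_n) : R := sl i * xi j0 + ic i.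
Notation q := crossing_height.

(** A height shared by two horizontal lines is exactly a point of multiplicity at least 3 on the
    vertical line. *)
Hypothesis local_neq1 : forall i, (exists2 i', i' != i & q i' = q i) ->
  rho0 * \prod_(j | q j == q i) rho j != 1.

Lemma height_shift i v : height i (p + v) = RtoC (q i) + RtoC (sl i) * v.
Proof. by rewrite /height /q /p RtoCD RtoCM; ring. Qed.

Section Local.
Variables (K d e : R).
Hypotheses (K1 : 1 <= K) (Ksl : forall i, `|sl i| + 1 <= K) (e0 : 0 < e) (ed : 32 * K * e < d)
  (sep : forall i j, q i != q j -> d < `|q i - q j|)
  (xisep : forall j, j != j0 -> e < cabs (RtoC (xi j) - p)).

Let x0 := p + RtoC e.

Let Ke0 : 0 < K * e. Proof. by apply: mulr_gt0 => //; have := K1; lra. Qed.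

Let base_shift v : v != 0 -> cabs v <= e -> base (p + v).
Proof.
move=> v0 ve j; apply/eqP => h; have [jj|jj] := eqVneq j j0.
  by move: h; rewrite jj -/p -[RHS]addr0 => /addrI /eqP; rewrite (negbTE v0).
by have := xisep jj; rewrite -h addrAC subrr add0r; lra.
Qed.

(** The [+ 1] in [Ksl] makes the bound strict even on the circle of radius e. *)
Let slope_small i v : cabs v <= e -> cabs (RtoC (sl i) * v) < K * e.
Proof.
move=> ve; rewrite cabsM cabs_RtoC; have s0 := normr_ge0 (sl i); have v0 := cabs_ge0 v.
have h1 : `|sl i| * cabs v <= `|sl i| * e by apply: ler_wpM2l.
have := Ksl i; have := e0; nra.
Qed.

Let off_other i j v y : q j != q i -> cabs v <= e -> cabs (y - RtoC (q i)) <= 6 * K * e ->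
  y != height j (p + v).
Proof.
move=> ne ve yi; apply/eqP => h; have := sep ne; rewrite -cabs_RtoC.
have -> : RtoC (q j - q i) = (y - RtoC (q i)) - RtoC (sl j) * v.
  by rewrite h height_shift RtoCB; ring.
have := cabsD (y - RtoC (q i)) (- (RtoC (sl j) * v)); rewrite cabsN.
by have := slope_small j ve; have := ed; have := Ke0; lra.
Qed.

Let far_other i j y : q j != q i -> cabs (y - RtoC (q i)) <= 6 * K * e ->
  K * e < cabs (y - RtoC (q j)).
Proof.
move=> ne yi; have := sep ne; rewrite -cabs_RtoC.
have -> : RtoC (q j - q i) = (y - RtoC (q i)) - (y - RtoC (q j)) by rewrite RtoCB; ring.
have := cabsD (y - RtoC (q i)) (- (y - RtoC (q j))); rewrite cabsN.
by have := ed; have := Ke0; lra.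
Qed.

Let off_self i j (v y : CC R) : q j = q i -> y != RtoC (q i) + RtoC (sl j) * v -> y != height j (p + v).
Proof. by move=> ji; rewrite height_shift ji. Qed.

Let cabs_e : cabs (RtoC e) = e.
Proof. by rewrite cabs_RtoC ger0_norm // ltW. Qed.

Let Re0 : RtoC e != 0.
Proof. by apply/eqP => /RtoC_inj h; move: e0; rewrite h ltxx. Qed.

Let x0E : x0 - p = RtoC e.
Proof. by rewrite /x0 addrAC subrr add0r. Qed.

Let base_x0 : base x0.
Proof. by apply: base_shift => //; rewrite cabs_e. Qed.

Let unit_le (t : R) (v : CC R) : cabs v <= e -> cabs (v * unit_circle t) <= e.
Proof. by rewrite cabsM cabs_unit mulr1. Qed.

Let unit_neq0 (t : R) (v : CC R) : v != 0 -> v * unit_circle t != 0.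
Proof. by move=> v0; rewrite mulf_neq0 // unit_circle_neq0. Qed.

(* Rotations around the vertical line at constant height, parallel to the i-th
   line, and around the point of height q i.  The last one surrounds all the
   lines through that point; at a double point its monodromy may be 1, and the
   second one is used instead. *)
Let loop_far (zt : E * R) : E := (p + (zt.1.1 - p) * unit_circle zt.2, zt.1.2).
Let loop_par i (zt : E * R) : E := (p + (zt.1.1 - p) * unit_circle zt.2,
  zt.1.2 + RtoC (sl i) * ((unit_circle zt.2 - 1) * (zt.1.1 - p))).
Let loop_hopf i (zt : E * R) : E := (p + (zt.1.1 - p) * unit_circle zt.2,
  RtoC (q i) + (zt.1.2 - RtoC (q i)) * unit_circle zt.2).

Let multiple i := [exists i', (i' != i) && (q i' == q i)].

Let loop (a : option 'I_n) : E * R -> E :=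
  if a is Some i then if multiple i then loop_hopf i else loop_par i else loop_far.

Let loop_cont a : continuous (loop a).
Proof.
case: a => [i|] /=; last by rewrite /loop_far; prove_continuous.
by case: multiple; rewrite /loop_par /loop_hopf; prove_continuous.
Qed.

Let loop_ends a z (t : R) : unit_circle t = 1 :> CC R -> loop a (z, t) = z.
Proof.
case: z => x y u1; case: a => [i|] /=; last first.
  by rewrite /loop_far /= u1; congr pair; ring.
by case: multiple; rewrite /loop_par /loop_hopf /= u1; congr pair; ring.
Qed.

Let loop0 a z : loop a (z, 0) = z. Proof. by rewrite loop_ends // unit_circle0. Qed.
Let loop1 a z : loop a (z, 1) = z. Proof. by rewrite loop_ends // unit_circle1. Qed.

Let region (a : option 'I_n) : set E :=
  if a is Some i then [set z | cabs (z.2 - RtoC (q i)) < 4 * K * e]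
  else [set z | forall i, 3 * K * e < cabs (z.2 - RtoC (q i))].

(** The far domain is not confined to the fibre over [x0]: x runs over the whole circle of radius e,
    because the loops of the near families have to stay inside it. Height distance K e suffices
    there, since the lines stay within K e of their crossing heights over that circle. *)
Let dom (a : option 'I_n) : set E :=
  if a is Some i then [set z | fibre M x0 z /\ cabs (z.2 - RtoC (q i)) < 4 * K * e]
  else [set z | cabs (z.1 - p) = e /\ forall i, K * e < cabs (z.2 - RtoC (q i))].

(** In coordinates centred at (p, q i) the loop multiplies by unit complex numbers, so it preserves
    each line through the centre; the other lines are too far away. *)
Let hopf_in i y (t : R) : (forall j, y != height j x0) ->
  cabs (y - RtoC (q i)) <= 6 * K * e -> M (loop_hopf i ((x0, y), t)).
Proof.
move=> yh yi; apply/ME; rewrite /= x0E; split.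
  by apply: base_shift; [exact: unit_neq0|apply: unit_le; rewrite cabs_e].
move=> j; have [ji|ji] := eqVneq (q j) (q i).
  apply: (off_self ji); apply: contra_neq (yh j) => h.
  rewrite /x0 height_shift ji -[LHS](subrK (RtoC (q i))) addrC; congr (_ + _).
  by apply: (mulIf (unit_circle_neq0 t)); apply: (addrI (RtoC (q i))); rewrite h; ring.
apply: (off_other ji); first by apply: unit_le; rewrite cabs_e.
by rewrite addrAC subrr add0r cabsM cabs_unit mulr1.
Qed.

Let par_shift i (z : CC R) : cabs z <= 2 -> cabs (RtoC (sl i) * (z * RtoC e)) <= 2 * K * e.
Proof.
move=> z2; rewrite mulrCA cabsM; have h : cabs (RtoC e) <= e by rewrite cabs_e.
have := slope_small i h; have := cabs_ge0 z; have := cabs_ge0 (RtoC (sl i) * RtoC e); nra.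
Qed.

Let unit_sub1 (t : R) : cabs (unit_circle t - 1) <= 2.
Proof.
apply: le_trans (cabsD _ _) _; rewrite cabsN cabs_unit.
by have -> : 1 = RtoC 1 :> CC R by []; rewrite cabs_RtoC normr1; lra.
Qed.

Let not_multiple i j : ~~ multiple i -> j != i -> q j != q i.
Proof. by move=> /existsPn /(_ j); rewrite negb_and => /orP[/negbTE ->|]. Qed.

Let loop_in a z (t : R) : dom a z -> 0 <= t <= 1 -> M (loop a (z, t)).
Proof.
case: z => x y; case: a => [i|] /=; last first.
  move=> [xp yq] t01; apply/ME; rewrite /=; split.
    apply: base_shift; last by apply: unit_le; rewrite xp.
    apply: unit_neq0; apply/eqP => h; move: e0; rewrite -xp h cabs0 ltxx.
    by [].
  move=> i; apply/eqP => h; have := yq i; rewrite h height_shift addrAC subrr add0r.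
  have /(slope_small i) : cabs ((x - p) * unit_circle t) <= e by apply: unit_le; rewrite xp.
  by lra.
move=> [[Mxy /= xx0] yi] t01; subst x; have [_ yh] := proj1 (ME _ _) Mxy.
case: ifPn => [mi|smi]; first by apply: hopf_in => //; have := Ke0; lra.
apply/ME; rewrite /= x0E; split.
  by apply: base_shift; [exact: unit_neq0|apply: unit_le; rewrite cabs_e].
move=> j; have [->|ji] := eqVneq j i.
  apply: contra_neq (yh i) => h; rewrite /x0 height_shift.
  apply: (addIr (RtoC (sl i) * ((unit_circle t - 1) * RtoC e))); rewrite h height_shift; ring.
apply: (off_other (not_multiple smi ji)); first by apply: unit_le; rewrite cabs_e.
rewrite addrAC; apply: le_trans (cabsD _ _) _.
by have := par_shift i (unit_sub1 t); have := Ke0; lra.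
Qed.

Let hopf_lin i y : (forall j, y != height j x0) -> cabs (y - RtoC (q i)) < 4 * K * e ->
  lin F (fun t => loop_hopf i ((x0, y), t)) = rho0 * \prod_(j | q j == q i) rho j.
Proof.
move=> yh yi.
pose h j := q j + sl j * e.
have hE j : height j x0 = RtoC (h j) by rewrite /x0 height_shift /h RtoCD RtoCM.
have hclose j : `|h j - q j| < K * e.
  by rewrite /h addrAC subrr add0r -cabs_RtoC RtoCM; apply: slope_small; rewrite cabs_e.
(* On the torus |x - p| = e, |y - q i| = K e the lines through the point have |y - q i| < K e and
   the others are far away, so both circles can be run through independently. *)
pose y1 := RtoC (q i) + RtoC (K * e).
have y1i : y1 - RtoC (q i) = RtoC (K * e) by rewrite /y1 addrAC subrr add0r.
have cKe : cabs (RtoC (K * e)) = K * e by rewrite cabs_RtoC ger0_norm // ltW.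
have y1h j : y1 != height j x0.
  have [ji|ji] := eqVneq (q j) (q i); last first.
    by apply: (off_other ji); rewrite ?cabs_e // y1i cKe; have := Ke0; lra.
  apply/eqP => /(congr1 (fun z => cabs (z - RtoC (q j)))).
  rewrite [X in cabs (y1 - RtoC X)]ji y1i cKe hE -RtoCB cabs_RtoC.
  by have := hclose j; lra.
(* The bulge is at most |y1 - y| / 8 <= K e, so the arc from y to y1 stays within 5 K e of [q i],
   inside the range allowed by [hopf_in]. *)
have k00 : 0 < (8^-1 : R) by lra.
have [k [kp k8 av]] := avoid_arc k00 yh y1h.
pose g (t : R) := y + (RtoC t + CCi R * RtoC (k * (t * (1 - t)))) * (y1 - y).
have gclose t : 0 <= t <= 1 -> cabs (g t - RtoC (q i)) <= 6 * K * e.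
  move=> t01.
  have -> : g t - RtoC (q i) = RtoC (1 - t) * (y - RtoC (q i)) + RtoC t * (y1 - RtoC (q i))
      + CCi R * RtoC (k * (t * (1 - t))) * (y1 - y) by rewrite /g RtoCB RtoC1; ring.
  have ci : cabs (CCi R) = 1 by rewrite /cabs /= expr0n expr1n add0r sqrtr1.
  have a1 : cabs (RtoC (1 - t) * (y - RtoC (q i))) <= (1 - t) * (4 * K * e).
    rewrite cabsM cabs_RtoC ger0_norm; last by lra.
    by apply: ler_wpM2l; [lra|exact: ltW].
  have a2 : cabs (RtoC t * (y1 - RtoC (q i))) <= t * (K * e).
    by rewrite cabsM cabs_RtoC ger0_norm; [rewrite y1i cKe|lra].
  have a3 : cabs (y1 - y) <= 5 * (K * e).
    have -> : y1 - y = (y1 - RtoC (q i)) - (y - RtoC (q i)) by ring.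
    by apply: le_trans (cabsD _ _) _; rewrite cabsN y1i cKe; lra.
  have a4 : cabs (CCi R * RtoC (k * (t * (1 - t))) * (y1 - y)) <= K * e.
    have tt0 : 0 <= t * (1 - t) by apply: mulr_ge0; lra.
    have tt1 : t * (1 - t) <= 1 by move: t01 => /andP[t0 t1]; nra.
    have u0 : 0 <= k * (t * (1 - t)) by apply: mulr_ge0 => //; exact: ltW.
    have u1 : k * (t * (1 - t)) <= 8^-1 by apply: le_trans (ler_wpM2l (ltW kp) tt1) _; lra.
    rewrite !cabsM ci mul1r cabs_RtoC ger0_norm //.
    by apply: le_trans (ler_wpM2r (cabs_ge0 _) u1) _; have := Ke0; lra.
  apply: le_trans (cabsD _ _) _; have := cabsD (RtoC (1 - t) * (y - RtoC (q i))) (RtoC t * (y1 - RtoC (q i))).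
  have := Ke0; move: t01 => /andP[t0 t1]; nra.
(* Move y to y1, off which the diagonal loop of the torus T is the product of a
   vertical meridian and of a circle in the fibre around the lines through the
   point of height q i. *)
transitivity (lin F (fun t => loop_hopf i ((x0, y1), t))).
  pose H (st : R * R) := loop_hopf i ((x0, g st.1), st.2).
  have sq : square_in M H.
    split; first by rewrite /H /loop_hopf /g; prove_continuous.
    by move=> s t s01 t01; apply: hopf_in; [exact: av|exact: gclose].
  have := lin_free_homotopy F sq; rewrite /H /=.
  have -> : g 0 = y by rewrite /g !RtoCM RtoC0; ring.
  have -> : g 1 = y1 by rewrite /g subrr !RtoCM RtoC0 RtoC1; ring.
  by apply=> s; rewrite /loop_hopf /= unit_circle0 unit_circle1.
pose T (st : R * R) : E := (p + RtoC e * unit_circle st.1, RtoC (q i) + RtoC (K * e) * unit_circle st.2).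
have sq : square_in M T.
  split; first by rewrite /T; prove_continuous.
  move=> s t s01 t01; apply/ME; split.
    by apply: base_shift; [exact: unit_neq0|apply: unit_le; rewrite cabs_e].
  have yc : cabs (RtoC (q i) + RtoC (K * e) * unit_circle t - RtoC (q i)) = K * e.
    by rewrite addrAC subrr add0r cabsM cabs_unit mulr1.
  have se : cabs (RtoC e * unit_circle s) <= e by apply: unit_le; rewrite cabs_e.
  move=> j; have [ji|ji] := eqVneq (q j) (q i); last first.
    by apply: (off_other ji) => //; rewrite yc; have := Ke0; lra.
  apply/eqP => /= hh; move: yc; rewrite hh height_shift ji addrAC subrr add0r.
  by have := slope_small j se; lra.
transitivity (lin F (fun t => T (t, t))).
  by congr (lin F _); apply/funext => t; rewrite /T /loop_hopf /= x0E y1i.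
rewrite (lin_diagonal F sq); congr (_ * _).
  rewrite -(@lin_ver (RtoC e) 0 y1) //.
  - by congr (lin F _); apply/funext => t; rewrite /T /= unit_circle0 /y1; congr pair; ring.
  - by move=> j jj; rewrite cabs_e; exact: xisep.
  - move=> j z z1; rewrite mulr0 addr0.
    have ze : cabs (z * RtoC e) <= e.
      by rewrite cabsM cabs_e; have := e0; have := cabs_ge0 z; nra.
    have [ji|ji] := eqVneq (q j) (q i); last first.
      by apply: (off_other ji) => //; rewrite y1i cKe; have := Ke0; lra.
    apply/eqP => hh; move: cKe; rewrite -y1i hh height_shift ji addrAC subrr add0r.
    by have := slope_small j ze; lra.
(* As e is real, the heights over [x0] are real and [circle_prod] applies; the circle of radius K e
   around [q i] encloses just the lines through the point. *)
pose emb (y : CC R) : E := (x0, y).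
have h_inj : injective h.
  move=> j j' hh; apply/eqP; apply/negPn/negP => ne.
  by have := crossing base_x0 ne; rewrite !hE hh eqxx.
have emb_cont : continuous emb by rewrite /emb; prove_continuous.
have emb_in y' : (forall j, y' != RtoC (h j)) -> M (emb y').
  by move=> y'h; apply/ME; split => // j; rewrite hE.
have small j (r : R) : 0 < r -> (forall j', j' != j -> r < `|h j' - h j|) ->
    lin F (fun t => emb (RtoC (h j) + unit_circle t * RtoC r)) = rho j.
  move=> r0 rj; rewrite -hE; apply: lin_hor => // j' /rj.
  by rewrite !hE -RtoCB cabs_RtoC.
have inside j : (`|h j - q i| < K * e) = (q j == q i).
  have [ji|ji] := eqVneq (q j) (q i); first by rewrite -ji hclose.
  apply/negP => hj; have := sep ji; have := hclose j.
  have := ler_normD (- (h j - q j)) (h j - q i); rewrite normrN.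
  have -> : - (h j - q j) + (h j - q i) = q j - q i by ring.
  by have := ed; have := Ke0; lra.
have ne j : `|h j - q i| != K * e.
  have [ji|ji] := eqVneq (q j) (q i); first by rewrite -ji lt_eqF.
  apply/eqP => hj; have := sep ji; have := hclose j.
  have := ler_normD (- (h j - q j)) (h j - q i); rewrite normrN.
  have -> : - (h j - q j) + (h j - q i) = q j - q i by ring.
  by have := ed; have := Ke0; lra.
have := circle_prod h_inj emb_cont emb_in small Ke0 ne.
rewrite (eq_bigl _ _ inside) => <-; congr (lin F _); apply/funext => t.
by rewrite /T /emb /= unit_circle1 mulr1 /x0 mulrC.
Qed.

Let loop_lin a z : dom a z -> lin F (fun t => loop a (z, t)) != 1.
Proof.
case: z => x y; case: a => [i|] /=; last first.
  move=> [xp yq]; rewrite (_ : lin F _ = rho0) // -(@lin_ver (x - p) 0 y).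
  - by congr (lin F _); apply/funext => t; rewrite /loop_far /=; congr pair; ring.
  - by apply/eqP => h; move: e0; rewrite -xp h cabs0 ltxx.
  - by move=> j jj; rewrite xp; exact: xisep.
  - move=> i z z1; rewrite mulr0 addr0; apply/eqP => h; have := yq i.
    rewrite h height_shift addrAC subrr add0r.
    have /(slope_small i) : cabs (z * (x - p)) <= e.
      by rewrite cabsM xp; have := e0; have := cabs_ge0 z; nra.
    by lra.
move=> [[Mxy /= xx0] yi]; subst x; have [_ yh] := proj1 (ME _ _) Mxy.
case: ifPn => [mi|smi].
  rewrite hopf_lin //; apply: local_neq1.
  by move/existsP: mi => [i' /andP[? /eqP ?]]; exists i'.
(* The loop bounds a disc in the parallel to the i-th line through (x0, y), which meets the vertical
   line at height y - sl i * e. *)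
rewrite (_ : lin F _ = rho0) // -(@lin_ver (RtoC e) (RtoC (sl i) * RtoC e) (y - RtoC (sl i) * RtoC e)) //.
- by congr (lin F _); apply/funext => t; rewrite /loop_par /= x0E; congr pair; ring.
- by move=> j jj; rewrite cabs_e; exact: xisep.
move=> j z z1.
have ze : cabs (z * RtoC e) <= e.
  by rewrite cabsM cabs_e; have := e0; have := cabs_ge0 z; nra.
have [->|ji] := eqVneq j i.
  apply: contra_neq (yh i) => h; rewrite /x0 height_shift.
  apply: (addIr (- (RtoC (sl i) * RtoC e) + z * (RtoC (sl i) * RtoC e))).
  by rewrite addrA h height_shift; ring.
apply: (off_other (not_multiple smi ji)) => //.
have -> : y - RtoC (sl i) * RtoC e + z * (RtoC (sl i) * RtoC e) - RtoC (q i) =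
  (y - RtoC (q i)) + RtoC (sl i) * ((z - 1) * RtoC e) by ring.
apply: le_trans (cabsD _ _) _.
have z12 : cabs (z - 1) <= 2.
  apply: le_trans (cabsD _ _) _; rewrite cabsN.
  by have -> : 1 = RtoC 1 :> CC R by []; rewrite cabs_RtoC normr1; lra.
by have := par_shift i z12; have := Ke0; lra.
Qed.

Let sect a (z : E) := fixpt F (fun t => loop a (z, t)).

(** The near loop at z stays in the domain of the far section. Flatness of that section along the
    loop says that its value at z is fixed by the loop, and such a value is unique. *)
Let sect_agree i z : fibre M x0 z -> region None z -> region (Some i) z ->
  sect None z = sect (Some i) z.
Proof.
move=> Vz far near_; apply/fixptP; first exact: loop_lin.
have fl : flat F (dom None) (sect None).
  apply: (@flat_fixpt _ _ F (dom None) (loop None) (@loop_cont None) (@loop0 None) (@loop1 None)).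
    by move=> z' t; exact: loop_in.
  by move=> z'; exact: loop_lin.
have := fl (fun t => loop (Some i) (z, t)); rewrite loop0 loop1 => <- //.
split.
  by apply: (@continuous_compose _ _ _ (loop (Some i)) (fun t => (z, t)) (@loop_cont (Some i))); prove_continuous.
case: z Vz far near_ => x y [Mxy /= xx0] far near_ t t01; subst x.
have first_ : cabs (RtoC e * unit_circle t) = e by rewrite cabsM cabs_unit mulr1.
have far_all y' : K * e < cabs (y' - RtoC (q i)) -> cabs (y' - RtoC (q i)) <= 6 * K * e ->
    forall j, K * e < cabs (y' - RtoC (q j)).
  move=> h1 h2 j; have [->//|ji] := eqVneq (q j) (q i).
  exact: far_other ji h2.
rewrite /dom /loop; case: ifPn => [mi|smi]; split; rewrite /= ?x0E.
- by rewrite addrAC subrr add0r.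
- apply: far_all; rewrite addrAC subrr add0r cabsM cabs_unit mulr1.
    by have := far i; have := Ke0; lra.
  by have := Ke0; lra.
- by rewrite addrAC subrr add0r.
- set w := RtoC (sl i) * _; have wb : cabs w <= 2 * K * e by exact: par_shift (unit_sub1 t).
  apply: far_all.
    have -> : y + w - RtoC (q i) = (y - RtoC (q i)) + w by ring.
    have := cabsD (y - RtoC (q i) + w) (- w); rewrite addrK cabsN.
    by have := far i; have := Ke0; lra.
  have -> : y + w - RtoC (q i) = (y - RtoC (q i)) + w by ring.
  by apply: le_trans (cabsD _ _) _; have := Ke0; lra.
Qed.

(** Two near regions meet only if the crossing heights are equal; both indices are then [multiple],
    and [loop_hopf] depends on the index through [q] alone. *)
Let sect_agree2 i j z : region (Some i) z -> region (Some j) z -> sect (Some i) z = sect (Some j) z.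
Proof.
have [->//|ij] := eqVneq i j; move=> /= zi zj.
have qij : q i = q j.
  apply/eqP/negPn/negP => ne; have := sep ne; rewrite -cabs_RtoC.
  have -> : RtoC (q i - q j) = - (z.2 - RtoC (q i)) + (z.2 - RtoC (q j)) by rewrite RtoCB; ring.
  have := cabsD (- (z.2 - RtoC (q i))) (z.2 - RtoC (q j)); rewrite cabsN.
  by have := ed; have := Ke0; lra.
have mi : multiple i by apply/existsP; exists j; rewrite eq_sym ij qij eqxx.
have mj : multiple j by apply/existsP; exists i; rewrite ij qij eqxx.
by rewrite /sect /loop mi mj /loop_hopf qij.
Qed.

Lemma flat_fibre_near : base x0 /\ exists psi, flat F (fibre M x0) psi.
Proof.
split; first exact: base_x0.
apply: (@flat_glue _ _ F (option 'I_n) dom region sect).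
- by move=> z [].
- move=> z _; have [[i hi]|nx] := pselect (exists i, cabs (z.2 - RtoC (q i)) < 4 * K * e).
    by exists (Some i).
  exists None => i /=; rewrite ltNge; apply/negP => h; apply: nx; exists i.
  by have := Ke0; lra.
- by case=> [i|] z /=; [exact: nbhs_snd_lt|exact: nbhs_snd_gt].
- case=> [i|] z /= [Vz Oz]; first by [].
  split=> [|i]; first by rewrite (proj2 Vz) x0E cabs_e.
  by have := Oz i; have := Ke0; lra.
- move=> a; apply: (@flat_fixpt _ _ F (dom a) (loop a) (@loop_cont a) (@loop0 a) (@loop1 a)).
    by move=> z t; exact: loop_in.
  by move=> z; exact: loop_lin.
- case=> [i|] [j|] z Vz Oi Oj //.
  + exact: sect_agree2.
  + by apply/esym; apply: sect_agree.
  + exact: sect_agree.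
Qed.

End Local.

Lemma flat_near_vertical : exists x, base x /\ exists psi, flat F (fibre M x) psi.
Proof.
have [K' K'1 Ksl'] := exists_above sl.
pose K := K' + 1.
have K1 : 1 <= K by rewrite /K; lra.
have Ksl i : `|sl i| + 1 <= K by rewrite /K lerD2r.
have c0 (ij : 'I_n * 'I_n) : 0 < if q ij.1 == q ij.2 then 1 else `|q ij.1 - q ij.2|.
  by case: ifPn => // ne; rewrite normr_gt0 subr_eq0.
have [d [d0 _ dc]] := exists_below c0 ltr01.
have sep i j : q i != q j -> d < `|q i - q j|.
  by move=> ij; have := dc (i, j); rewrite /= (negbTE ij).
have x0 j : 0 < if j == j0 then 1 else cabs (RtoC (xi j) - p).
  case: ifPn => // jj; apply: cabs_gt0; rewrite subr_eq0; apply: contra_neq jj.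
  by move=> /RtoC_inj /xi_inj.
have dK : 0 < d / (32 * K) by rewrite divr_gt0 //; lra.
have [e [e0 eK ex]] := exists_below x0 dK.
have ed : 32 * K * e < d by rewrite mulrC -ltr_pdivlMr //; lra.
have xisep j : j != j0 -> e < cabs (RtoC (xi j) - p).
  by move=> jj; have := ex j; rewrite (negbTE jj).
by exists (p + RtoC e); exact: (flat_fibre_near K1 Ksl e0 ed sep xisep).
Qed.

End NearVertical.

(** * First homology and flat sections *)

Section SeparatingFunctional.
Variables (K : fieldType) (V : lmodType K).
Implicit Types (W : set V) (f g z : V).

Definition subspace W := W 0 /\ forall (a : K) f g, W f -> W g -> W (a *: f + g).

(** A maximal subspace U among those that contain W and avoid z satisfies V = U + K z, and [phi] is
    the coordinate along z. Zorn is applied to sets A with A united to W a subspace, because the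
    union of the empty chain is empty and not a subspace. *)
Lemma separating_functional W z : subspace W -> ~ W z ->
  exists phi : V -> K,
    [/\ forall a f g, phi (a *: f + g) = a * phi f + phi g,
        forall f, W f -> phi f = 0 & phi z = 1].
Proof.
move=> sW Wz; pose P := [set A : set V | subspace (A `|` W) /\ ~ (A `|` W) z].
have [F FP Ftot|A [[sA Az] maxA]] := @Zorn_bigcup V P.
  split; last first.
    by move=> [[A FA Az]|//]; have [_ []] := FP A FA; left.
  split; first by right; case: sW.
  move=> a f g [[A FA Af]|Wf] [[B FB Bg]|Wg]; last first.
  - by right; apply: (proj2 sW).
  - have [[_ sB] _] := FP B FB.
    have [Bh|Wh] := sB a f g (or_intror Wf) (or_introl Bg); last by right.
    by left; exists B.
  - have [[_ sA] _] := FP A FA.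
    have [Bh|Wh] := sA a f g (or_introl Af) (or_intror Wg); last by right.
    by left; exists A.
  - have [C FC [Cf Cg]] : exists2 C, F C & C f /\ C g.
      by have [AB|BA] := Ftot A B FA FB; [exists B|exists A] => //; split => //; [exact: AB|exact: BA].
    have [[_ sC] _] := FP C FC.
    have [Ch|Wh] := sC a f g (or_introl Cf) (or_introl Cg); last by right.
    by left; exists C.
set U := A `|` W in sA Az; have [U0 Ulin] := sA.
have Uscale a f : U f -> U (a *: f) by move=> Uf; rewrite -[_ *: _]addr0; exact: Ulin.
have dec f : exists c, U (f - c *: z).
  have [Uf|Uf] := pselect (U f); first by exists 0; rewrite scale0r subr0.
  pose U' := [set h | exists a, U (h - a *: f)].
  have UU' : U `<=` U' by move=> h Uh; exists 0; rewrite scale0r subr0.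
  have U'W : U' `|` W = U'.
    by rewrite setUidl // => h Wh; apply: UU'; right.
  have U'f : U' f by exists 1; rewrite scale1r subrr.
  have U'z : U' z.
    apply: contrapT => nz; apply: (maxA U').
      split; first by move=> h Ah; apply: UU'; left.
      by move=> /(_ _ U'f) Af; apply: Uf; left.
    split; rewrite U'W //; split; first exact: UU'.
    move=> a h k [b Uh] [c Uk]; exists (a * b + c).
    have -> : a *: h + k - (a * b + c) *: f = a *: (h - b *: f) + (k - c *: f).
      by rewrite scalerBr scalerDl scalerA opprD addrACA.
    exact: Ulin.
  case: U'z => a Ua; have a0 : a != 0.
    by apply: contra_notN Az => /eqP a0; move: Ua; rewrite a0 scale0r subr0.
  exists a^-1; have -> : f - a^-1 *: z = (- a^-1) *: (z - a *: f).
    by rewrite scalerBr scalerA mulNr mulVf // !scaleNr scale1r opprK addrC.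
  exact: Uscale.
have uniq_c f c c' : U (f - c *: z) -> U (f - c' *: z) -> c = c'.
  move=> Uc Uc'; apply/eqP; rewrite -subr_eq0; apply/negPn/negP => cc; apply: Az.
  have -> : z = (c - c')^-1 *: (-1 *: (f - c *: z) + (f - c' *: z)).
    rewrite scaleN1r opprB addrA subrK -scalerBl scalerA mulVf // scale1r.
    by [].
  by apply: Uscale; exact: Ulin.
have [phi phiP] := choice dec; exists phi; split.
- move=> a f g; apply: uniq_c (phiP _) _.
  have -> : a *: f + g - (a * phi f + phi g) *: z = a *: (f - phi f *: z) + (g - phi g *: z).
    by rewrite scalerBr scalerDl scalerA opprD addrACA.
  by apply: Ulin; exact: phiP.
- by move=> f Wf; apply: uniq_c (phiP _) _; rewrite scale0r subr0; right.
- by apply: uniq_c (phiP _) _; rewrite scale1r subrr.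
Qed.

End SeparatingFunctional.

(** * Vanishing of first homology from flat sections of cocycles *)

Section FlatHomology.
Variables (R : realType) (X : topologicalType) (L : local_system R X).
Notation chain k := (sing R X k -> (CC R)^o).

Lemma finite_sum_chain (T : choiceType) (c G : T -> CC R) (r : seq T) : uniq r ->
  (forall s, s \notin r -> c s = 0) ->
  \sum_(s \in [set: T]) c s * G s = \sum_(s <- r) c s * G s.
Proof.
move=> ur cr; rewrite (fsbigE r) //.
  by apply: eq_bigl => s; rewrite in_setT.
by move=> s _ /cr ->; rewrite mul0r.
Qed.

Lemma chain_supp k (c : chain k) : is_chain c ->
  exists2 r : seq (sing R X k), uniq r & forall s, s \notin r -> c s = 0.
Proof.
move=> /finite_seqP[r rE]; exists (undup r); first exact: undup_uniq.
move=> s; rewrite mem_undup => sr; apply/eqP/negPn/negP => cs.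
have : [set s | c s != 0] s by [].
by rewrite rE /= (negbTE sr).
Qed.

Lemma supp_chain k (c : chain k) (r : seq (sing R X k)) :
  (forall s, s \notin r -> c s = 0) -> is_chain c.
Proof.
move=> cr; apply: (@sub_finite_set _ _ [set` r]); last exact: finite_seq.
by move=> s /= cs; apply/negPn/negP => /cr h; rewrite h eqxx in cs.
Qed.

Lemma boundary_subspace k : subspace (fun c : chain k => is_boundary L c).
Proof.
split.
  exists (fun=> 0); first by apply: (@supp_chain _ _ [::]).
  by apply/funext => t; rewrite /boundary fsbig1 // => s _; rewrite mul0r.
move=> a _ _ [b bc <-] [b' b'c <-].
have [r ur br] := chain_supp bc; have [r' ur' br'] := chain_supp b'c.
pose w := undup (r ++ r'); have uw : uniq w by exact: undup_uniq.
have bw s : s \notin w -> b s = 0.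
  by rewrite mem_undup mem_cat negb_or => /andP[/br].
have b'w s : s \notin w -> b' s = 0.
  by rewrite mem_undup mem_cat negb_or => /andP[_ /br'].
have bbw s : s \notin w -> a * b s + b' s = 0.
  by move=> sw; rewrite bw // b'w // mulr0 addr0.
exists (fun s => a * b s + b' s); first exact: supp_chain bbw.
apply/funext => t; rewrite /boundary (finite_sum_chain _ uw bbw).
rewrite !fctE (finite_sum_chain _ uw bw) (finite_sum_chain _ uw b'w).
rewrite /GRing.scale /= mulr_sumr -big_split /=; apply: eq_bigr => s _.
by rewrite mulrDl mulrA.
Qed.

Definition simplex_chain k (s : sing R X k) : chain k := fun t => (t == s)%:R.

Lemma sing_edge01E (s : sing R X 2) : sing_edge01 s = sing_face ord_max s.
Proof.
rewrite /sing_edge01 /sing_face; congr (_ \o simplex_map _).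
by apply/funext => -[[|[|//]] ?]; apply: val_inj.
Qed.

Lemma sing_edge01_id (u : sing R X 1) : sing_edge01 u = u.
Proof.
apply/continuousEP => x; rewrite /sing_edge01 /=; congr (u _); apply: val_inj => /=.
by apply/rowP => j; rewrite mxE (big_pred1 j) // => i.
Qed.

Lemma boundary_simplex2 (s : sing R X 2) :
  boundary L (simplex_chain s) =
  transport L (sing_face ord_max s) *: simplex_chain (sing_face ord0 s) +
  (-1 *: simplex_chain (sing_face (inord 1) s) + simplex_chain (sing_face ord_max s)).
Proof.
apply/funext => t; rewrite /boundary.
have r0 (s' : sing R X 2) : s' \notin [:: s] -> simplex_chain s s' = 0.
  by rewrite inE /simplex_chain => /negbTE ->.
rewrite (@finite_sum_chain _ _ _ [:: s]) // big_seq1 /simplex_chain eqxx mul1r !fctE.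
rewrite big_mkcond !big_ord_recl big_ord0 /= addr0 sing_edge01E.
have -> : lift ord0 ord0 = inord 1 :> 'I_3 by apply: val_inj; rewrite /= inordK.
have -> : lift ord0 (lift ord0 ord0) = ord_max :> 'I_3 by exact: val_inj.
rewrite /GRing.scale /= !expr0 ?expr1 !mul1r.
by do 3 case: eqP => _; rewrite ?mulr1 ?mulr0 ?sqrrN ?expr1n ?mulN1r.
Qed.

Lemma boundary_1E (c : chain 1) (r : seq (sing R X 1)) (t : sing R X 0) : uniq r ->
  (forall u, u \notin r -> c u = 0) ->
  boundary L c t = \sum_(u <- r) c u * (transport L u * (t == sing_face ord0 u)%:R
                                        - (t == sing_face ord_max u)%:R).
Proof.
move=> ur cr; rewrite /boundary (finite_sum_chain _ ur cr); apply: eq_bigr => u _.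
rewrite big_mkcond !big_ord_recl big_ord0 /= addr0 sing_edge01_id.
have -> : lift ord0 ord0 = ord_max :> 'I_2 by exact: val_inj.
rewrite (_ : bump 0 0 = 1%N) //.
by congr (_ * _); case: eqP => _; case: eqP => _ /=; rewrite ?expr0 ?expr1; ring.
Qed.

(** On a cycle z that is not a boundary, some functional [phi] killing boundaries has value 1. A
    flat section writes [phi] on each edge as minus the pairing of [psi] with its boundary; summing
    over z gives 1 = 0. *)
Lemma flat_H1_eq0 :
  (forall tra : sing R X 1 -> CC R,
     (forall s : sing R X 2, tra (sing_face (inord 1) s) =
        tra (sing_face ord_max s) + transport L (sing_face ord_max s) * tra (sing_face ord0 s)) ->
     exists psi : sing R X 0 -> CC R, forall u : sing R X 1,
       psi (sing_face ord_max u) = tra u + transport L u * psi (sing_face ord0 u)) ->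
  ~ dim_H1_gt0 L.
Proof.
move=> flat [z cz indep]; have [zc zb] := cz ord0.
have nb : ~ is_boundary L (z ord0 : chain 1).
  move=> [b bc be]; have := @indep (fun=> 1) _ ord0.
  have -> : (fun s => \sum_(i < 1) 1 * z i s) = z ord0.
    by apply/funext => s; rewrite big_ord1 mul1r.
  by move=> /(_ (ex_intro2 _ _ b bc be)) /eqP; rewrite oner_eq0.
have [phi [lin_phi phi0 phiz]] := separating_functional (@boundary_subspace 1) nb.
have phi_0 : phi 0 = 0 by apply: phi0; case: (@boundary_subspace 1).
have phiZ a f : phi (a *: f) = a * phi f by rewrite -[a *: f]addr0 lin_phi phi_0 addr0.
have phiD f g : phi (f + g) = phi f + phi g by rewrite -[f]scale1r lin_phi scale1r mul1r.
have [|psi flat_psi] := flat (fun u => phi (simplex_chain u)).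
  move=> s.
  have : phi (boundary L (simplex_chain s) : chain 1) = 0.
    apply: phi0; exists (simplex_chain s) => //.
    apply: (@supp_chain _ _ [:: s]) => s'.
    by rewrite inE /simplex_chain => /negbTE ->.
  rewrite boundary_simplex2 lin_phi phiD phiZ mulN1r => /eqP.
  by rewrite addrCA addrC subr_eq0 addrC => /eqP <-; rewrite addrC.
have [r ur zr] := chain_supp zc.
have zE : (z ord0 : chain 1) = \sum_(u <- r) (z ord0 u : CC R) *: simplex_chain u.
  apply/funext => t; rewrite fct_sumE /simplex_chain.
  have [tr|tr] := boolP (t \in r); last first.
    rewrite zr // big1_seq // => u /andP[_ ur']; rewrite fctE /GRing.scale /=.
    by case: eqP => [tu|_]; [rewrite tu ur' in tr|rewrite mulr0].
  rewrite (bigD1_seq t) //= big1 ?addr0 => [|u ut].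
    by rewrite fctE /GRing.scale /= eqxx mulr1.
  by rewrite fctE /GRing.scale /= eq_sym (negbTE ut) mulr0.
have phizE : phi (z ord0) = \sum_(u <- r) z ord0 u * phi (simplex_chain u).
  rewrite [in LHS]zE; elim: (r) => [|u r' IH]; first by rewrite !big_nil.
  by rewrite !big_cons lin_phi IH.
pose S := undup (map (sing_face ord0) r ++ map (sing_face ord_max) r).
have pick_S (f : sing R X 0 -> CC R) x : x \in S -> \sum_(t <- S) f t * (t == x)%:R = f x.
  move=> xS; rewrite (bigD1_seq x) ?undup_uniq //= eqxx mulr1 big1 ?addr0 // => t tx.
  by rewrite (negbTE tx) mulr0.
have : \sum_(t <- S) psi t * boundary L (z ord0) t = 0.
  by rewrite zb big1 // => t _; rewrite mulr0.
under eq_bigr do rewrite (boundary_1E _ ur zr) mulr_sumr.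
rewrite exchange_big /= big_seq.
have -> : \sum_(u <- r | u \in r) \sum_(t <- S) psi t * (z ord0 u *
    (transport L u * (t == sing_face ord0 u)%:R - (t == sing_face ord_max u)%:R)) =
  \sum_(u <- r | u \in r) - (z ord0 u * phi (simplex_chain u)).
  apply: eq_bigr => u ur'.
  have S0 : sing_face ord0 u \in S by rewrite mem_undup mem_cat map_f.
  have S1 : sing_face ord_max u \in S by rewrite mem_undup mem_cat map_f ?orbT.
  have -> : phi (simplex_chain u) = psi (sing_face ord_max u) - transport L u * psi (sing_face ord0 u).
    by rewrite flat_psi addrK.
  rewrite -(pick_S psi _ S0) -(pick_S psi _ S1) mulrBr opprB !mulr_sumr -sumrB.
  by apply: eq_bigr => t _; ring.
rewrite -big_seq sumrN -phizE phiz => /eqP; rewrite oppr_eq0 oner_eq0.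
by [].
Qed.

End FlatHomology.

(** * Affine local systems from singular simplices *)

Section Realization.
Variables (R : realType).
Notation E := (CC R * CC R)%type.
Variable (M : set E).
Notation X := (set_type M : topologicalType).

Lemma simplex_coord_continuous k (i : 'I_k.+1) :
  continuous (fun t : simplex R k => val t 0 i).
Proof.
move=> t; apply: (@continuous_comp _ _ _ (set_val : simplex R k -> _) (fun x : 'rV[R]_k.+1 => x 0 i)).
  exact: initial_continuous.
exact: coord_continuous.
Qed.

Lemma simplex_ge0 k (t : simplex R k) i : 0 <= val t 0 i.
Proof. by case: t => t /= /set_mem[]. Qed.

Lemma simplex_sum k (t : simplex R k) : \sum_i val t 0 i = 1.
Proof. by case: t => t /= /set_mem[]. Qed.

Lemma simplex1E (t : simplex R 1) : val t 0 0 = 1 - val t 0 1.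
Proof.
have := simplex_sum t; rewrite !big_ord_recl big_ord0 addr0 => <-.
rewrite (_ : lift ord0 ord0 = 1) ?addrK //; exact: val_inj.
Qed.

Lemma sing_exists k (g : simplex R k -> E) : continuous g -> (forall t, M (g t)) ->
  exists s : sing R X k, forall t, val (s t) = g t.
Proof.
move=> cg Mg; pose h t : X := exist (fun y => y \in M) (g t) (mem_set (Mg t)).
have ch : continuous h by apply: continuous_comp_initial.
by exists (mkcts ch : continuousType (simplex R k) X).
Qed.

Definition realizes (u : sing R X 1) (f : R -> E) := forall t, val (u t) = f (val t 0 1).

Lemma realizes_inj u v f : realizes u f -> realizes v f -> u = v.
Proof. by move=> uf vf; apply/continuousEP => t; apply: val_inj; rewrite uf vf. Qed.

Lemma realizes_exists f : path_in M f -> exists u, realizes u f.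
Proof.
move=> [cf Mf]; apply: sing_exists => [|t].
  by apply: continuous_compose => //; exact: simplex_coord_continuous.
by apply: Mf; rewrite simplex_ge0 /= -subr_ge0 -simplex1E simplex_ge0.
Qed.

Lemma triangle_exists G : triangle_in M G -> exists s : sing R X 2,
  [/\ realizes (sing_face ord_max s) (edge01 G), realizes (sing_face ord0 s) (edge12 G)
    & realizes (sing_face (inord 1) s) (edge02 G)].
Proof.
move=> [cG MG].
have [||s sE] := @sing_exists 2 (fun t => G (val t 0 0, val t 0 1, val t 0 (inord 2))).
- by apply: continuous_compose => //; do 2?apply: continuous_pair; exact: simplex_coord_continuous.
- move=> t; apply: MG; rewrite ?simplex_ge0 //.
  rewrite -(simplex_sum t) !big_ord_recl big_ord0 addr0 addrA.
  by congr (_ + _ + _); congr (val t 0 _); apply: val_inj; rewrite /= ?inordK.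
have i1 : inord 1 = Ordinal (isT : (1 < 3)%N) by apply: val_inj; rewrite /= inordK.
have i2 : inord 2 = Ordinal (isT : (2 < 3)%N) by apply: val_inj; rewrite /= inordK.
exists s; split=> t; rewrite sE /edge01 /edge12 /edge02 -simplex1E /= ?i1 i2.
all: congr (G (_, _, _)); rewrite !mxE big_mkcond !big_ord_recl big_ord0 /= ?addr0 ?add0r //.
all: by congr (val t 0 _); apply: val_inj.
Qed.

Section System.
Variables (tr ph : sing R X 1 -> CC R).
Hypothesis tr_neq0 : forall u, tr u != 0.
Hypothesis tr_comp : forall s : sing R X 2,
  tr (sing_face (inord 1) s) = tr (sing_face ord_max s) * tr (sing_face ord0 s).
Hypothesis ph_comp : forall s : sing R X 2,
  ph (sing_face (inord 1) s) =
  ph (sing_face ord_max s) + tr (sing_face ord_max s) * ph (sing_face ord0 s).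

(** The default c is taken to be 1 for linear parts, which must never vanish, and 0 for translation
    parts. *)
Definition extend (c : CC R) (v : sing R X 1 -> CC R) (f : R -> E) :=
  if pselect (exists u, realizes u f) is left ex then v (projT1 (cid ex)) else c.

Lemma extendE c v u f : realizes u f -> extend c v f = v u.
Proof.
move=> uf; rewrite /extend; case: pselect => [ex|[]]; last by exists u.
by case: cid => u' u'f /=; rewrite (realizes_inj u'f uf).
Qed.

Lemma extend_neq0 f : extend 1 tr f != 0.
Proof. by rewrite /extend; case: pselect => // _; exact: oner_neq0. Qed.

Lemma extend_lin_triangle G : triangle_in M G ->
  extend 1 tr (edge02 G) = extend 1 tr (edge01 G) * extend 1 tr (edge12 G).
Proof.
move=> /triangle_exists[s [f2 f0 f1]].
by rewrite (extendE _ _ f0) (extendE _ _ f1) (extendE _ _ f2).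
Qed.

Lemma extend_tra_triangle G : triangle_in M G ->
  extend 0 ph (edge02 G) = extend 0 ph (edge01 G) + extend 1 tr (edge01 G) * extend 0 ph (edge12 G).
Proof.
move=> /triangle_exists[s [f2 f0 f1]].
by rewrite (extendE _ _ f0) (extendE _ _ f1) !(extendE _ _ f2).
Qed.

Definition sing_system : affine_system M :=
  AffineSystem extend_neq0 extend_lin_triangle extend_tra_triangle.

Lemma lin_sing_system u f : realizes u f -> lin sing_system f = tr u.
Proof. exact: extendE. Qed.

Lemma tra_sing_system u f : realizes u f -> tra sing_system f = ph u.
Proof. exact: extendE. Qed.

(* The retraction of the line onto the unit interval. *)
Definition clamp (t : R) : R := (1 + `|t| - `|t - 1|) / 2.

Lemma clamp_id t : 0 <= t <= 1 -> clamp t = t.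
Proof.
move=> /andP[t0 t1]; rewrite /clamp ger0_norm // ler0_norm; last by lra.
by field.
Qed.

Lemma clamp01 t : 0 <= clamp t <= 1.
Proof.
rewrite /clamp; have := ler_norm t; have := ler_norm (- t); have := ler_norm (t - 1).
have := ler_norm (- (t - 1)); rewrite !normrN.
have := ler_normD t (-1); have := ler_normD (t - 1) 1; rewrite subrK normrN normr1.
by move=> *; apply/andP; split; lra.
Qed.

Lemma clamp_continuous : continuous clamp.
Proof.
have cn : continuous (fun t : R => `|t|) by move=> t; exact: norm_continuous.
have cn1 : continuous (fun t : R => `|t - 1|).
  by apply: (continuous_compose (f := fun t : R => `|t|)) => //; prove_continuous.
by rewrite /clamp; prove_continuous.
Qed.

Definition segment_row (t : R) : 'rV[R]_2 :=
  \row_(j < 2) (if j == 0 then 1 - clamp t else clamp t).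

Lemma segment_row_simplex t : segment_row t \in @std_simplex R 1.
Proof.
apply/mem_set; have /andP[c0 c1] := clamp01 t; split => [i|].
  by rewrite mxE; case: ifP => _; lra.
by rewrite !big_ord_recl big_ord0 !mxE /= addr0 subrK.
Qed.

Definition segment_point (t : R) : simplex R 1 :=
  exist (fun y => y \in @std_simplex R 1) _ (segment_row_simplex t).

Lemma segment_point_continuous : continuous segment_point.
Proof.
apply: continuous_comp_initial => t.
have -> : set_val \o segment_point =
    fun t => delta_mx 0 0 + clamp t *: (delta_mx 0 1 - delta_mx 0 0) :> 'rV[R]_2.
  apply/funext => s /=; apply/rowP => j; rewrite !mxE /=.
  by case: j => [[|[|//]] ?] /=; ring.
apply: cvgD; first exact: cvg_cst.
by apply: cvgZr_tmp; exact: clamp_continuous.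
Qed.

Lemma segment_pointK (t : simplex R 1) : segment_point (val t 0 1) = t.
Proof.
apply: val_inj; apply/rowP => j; rewrite !mxE clamp_id.
  case: eqP => [->|j0]; first by rewrite simplex1E.
  by congr (val t 0 _); apply: val_inj; case: j j0 => [[|[|//]] ?] //= []; apply: val_inj.
by rewrite simplex_ge0 /= -subr_ge0 -simplex1E simplex_ge0.
Qed.

Lemma vertex_simplex : (const_mx 1 : 'rV[R]_1) \in @std_simplex R 0.
Proof. by apply/mem_set; split => [i|]; rewrite ?big_ord1 mxE // ler01. Qed.

Definition vertex : simplex R 0 :=
  exist (fun y => y \in @std_simplex R 0) _ vertex_simplex.

(** Clamping the parameter turns the singular simplex into a path on the whole line. Its initial
    point is the face [ord_max], opposite to vertex 1, and its final point is the face [ord0]. *)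
Lemma flat_sing psi : flat sing_system M psi -> forall u : sing R X 1,
  psi (val (sing_face ord_max u vertex)) = ph u + tr u * psi (val (sing_face ord0 u vertex)).
Proof.
move=> fl u; pose f t := val (u (segment_point t)).
have uf : realizes u f by move=> t; rewrite /f segment_pointK.
have Mf : path_in M f.
  split; last by move=> t _; rewrite /f; case: (u _) => x /= /set_mem.
  move=> t; apply: (@continuous_comp _ _ _ (fun t => u (segment_point t)) (set_val : X -> _)).
    by apply: continuous_comp; [exact: segment_point_continuous|exact: cts_fun].
  exact: initial_continuous.
have := fl f Mf; rewrite /act (lin_sing_system uf) (tra_sing_system uf).
suff [-> ->] : f 0 = val (sing_face ord_max u vertex) /\ f 1 = val (sing_face ord0 u vertex) by [].
split; rewrite /f /sing_face /=; congr (val (u _)); apply: val_inj; apply/rowP => j.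
  rewrite !mxE clamp_id; last by rewrite lexx ler01.
  by rewrite big_mkcond big_ord1 mxE; case: j => [[|[|//]] ?] /=; rewrite ?subr0.
rewrite !mxE clamp_id; last by rewrite lexx ler01.
by rewrite big_mkcond big_ord1 mxE; case: j => [[|[|//]] ?] /=; rewrite ?subrr.
Qed.

End System.

End Realization.

(** * Fibered arrangements *)

Section Hypersurfaces.
Import -(notations) mpoly.
Variables (R : realType) (N : nat).
Implicit Types (f : mpoly N (CC R)) (rho : 'I_N -> CC R) (Z : set ('I_N -> CC R)).

Definition hypersurface f : set ('I_N -> CC R) := [set rho | torus rho /\ meval rho f = 0].

Lemma hypersurface_closed f : zariski_closed (hypersurface f).
Proof.
exists [set f]; apply/seteqP; split=> rho [Trho h]; split=> //; last exact: h.
by move=> _ ->.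
Qed.

(** The union of the hypersurfaces is the hypersurface of the product, from which irreducibility
    splits off one factor at a time. The empty product is 1 and has no zero, whereas Z is
    nonempty. *)
Lemma irreducible_hypersurfaces (I : eqType) (s : seq I) (f : I -> mpoly N (CC R)) Z :
  zariski_irreducible Z -> (forall rho, Z rho -> exists2 i, i \in s & meval rho (f i) = 0) ->
  exists2 i, i \in s & Z `<=` hypersurface (f i).
Proof.
move=> [ZT [rho0 Z0] irr] cov; have : Z `<=` hypersurface (\prod_(i <- s) f i).
  move=> rho Zrho; split; first exact: ZT.
  have [i si fi0] := cov rho Zrho.
  by rewrite rmorph_prod /=; apply/eqP; rewrite prodf_seq_eq0; apply/hasP; exists i => //=; rewrite fi0.
elim: s {cov} => [|i s IH] cov.
  by have [_] := cov _ Z0; rewrite big_nil meval1 => /eqP; rewrite oner_eq0.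
have := irr _ _ (hypersurface_closed (f i)) (hypersurface_closed (\prod_(j <- s) f j)).
case=> [rho Zrho|Zi|/IH[j js Zj]]; last first.
- by exists j => //; rewrite inE js orbT.
- by exists i => //; rewrite inE eqxx.
have [Trho] := cov rho Zrho; rewrite big_cons mevalM => /eqP.
by rewrite mulf_eq0 => /orP[] /eqP h; [left|right].
Qed.

Definition monomial_minus1 (S : {set 'I_N}) : mpoly N (CC R) :=
  \prod_(k in S) mpolyX (CC R) (mnm1 k) - 1.

Lemma meval_monomial_minus1 rho S : meval rho (monomial_minus1 S) = \prod_(k in S) rho k - 1.
Proof.
rewrite mevalB meval1 rmorph_prod; congr (_ - _).
by apply: eq_bigr => k _; exact: mevalXU.
Qed.

Lemma irreducible_monomials (I : eqType) (s : seq I) (S : I -> {set 'I_N}) Z :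
  zariski_irreducible Z ->
  (forall rho, Z rho -> exists2 i, i \in s & \prod_(k in S i) rho k = 1) ->
  exists2 i, i \in s & forall rho, Z rho -> \prod_(k in S i) rho k = 1.
Proof.
move=> irr cov.
have [|i si Zi] := @irreducible_hypersurfaces _ s (fun i => monomial_minus1 (S i)) Z irr.
  move=> rho /cov[i si Si]; exists i => //.
  by rewrite meval_monomial_minus1 Si subrr.
exists i => // rho /Zi[_]; rewrite meval_monomial_minus1 => /eqP.
by rewrite subr_eq0 => /eqP.
Qed.

End Hypersurfaces.

(** * The arrangement in coordinates *)

Section FiberedArrangement.
Variables (R : realType) (n m : nat) (A : 'I_(n + m) -> real_line R).
Hypothesis hA : real_fibered_arrangement A.
Notation E := (CC R * CC R)%type.
Let M : set E := [set P | forall k, ~ line A k P].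

Definition slope_of i := - (x_coef (A (lshift m i)) / y_coef (A (lshift m i))).
Definition icept_of i := - (const_coef (A (lshift m i)) / y_coef (A (lshift m i))).
Definition abscissa j := - (const_coef (A (rshift n j)) / x_coef (A (rshift n j))).

Notation height := (height slope_of icept_of).
Notation base := (base abscissa).

Lemma y_coef_hor i : y_coef (A (lshift m i)) != 0.
Proof.
have [_ hor _ _] := hA; apply/eqP => b0.
have a0 : x_coef (A (lshift m i)) != 0.
  by have := coef_neq0 (A (lshift m i)); rewrite b0 xpair_eqE eqxx andbT.
(* At this abscissa the left side a x + c of the equation equals 1. *)
have : setT (RtoC ((1 - const_coef (A (lshift m i))) / x_coef (A (lshift m i)))) by [].
rewrite -(hor i) => -[[x y] /=]; rewrite /line /= b0 => h xE.
move: h; rewrite xE RtoC0 mul0r addr0 -RtoCM mulrC divfK // -RtoCD subrK.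
by move=> /(congr1 (@complex.Re R)) /= /eqP; rewrite oner_eq0.
Qed.

Lemma line_hor i x y : line A (lshift m i) (x, y) <-> y = height i x.
Proof.
rewrite /line /height /slope_of /icept_of /=.
have b0 := y_coef_hor i.
set a := x_coef _; set b := y_coef _ in b0 *; set c := const_coef _.
have b0' : RtoC b != 0 by apply: contra_neq b0 => /(@RtoC_inj R b 0).
have Va : RtoC (- (a / b)) = - (RtoC a / RtoC b).
  by apply: (mulIf b0'); rewrite mulNr divfK // -RtoCM mulNr divfK // RtoCN.
have Vc : RtoC (- (c / b)) = - (RtoC c / RtoC b).
  by apply: (mulIf b0'); rewrite mulNr divfK // -RtoCM mulNr divfK // RtoCN.
rewrite Va Vc; split=> [h|->]; last by field.
apply: (mulfI b0'); apply/eqP; rewrite -subr_eq0; apply/eqP; rewrite -h; field.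
by [].
Qed.

Lemma line_ver j x y : line A (rshift n j) (x, y) <-> x = RtoC (abscissa j).
Proof.
have [_ _ ver _] := hA; have [xi0 _ lE] := ver j.
(* Two points of the same fibre lie on the line, which forces its y coefficient to vanish. *)
have l0 : line A (rshift n j) (xi0, 0) by rewrite lE.
have l1 : line A (rshift n j) (xi0, 1) by rewrite lE.
rewrite /line /= in l0 l1.
have b0 : y_coef (A (rshift n j)) = 0.
  have diff (u v w : CC R) : u + v * 0 + w = 0 -> u + v * 1 + w = 0 -> v = 0.
    move=> h0 h1; have -> : v = (u + v * 1 + w) - (u + v * 0 + w) by ring.
    by rewrite h0 h1 subrr.
  by apply: (@RtoC_inj R); exact: diff l0 l1.
have a0 : x_coef (A (rshift n j)) != 0.
  by have := coef_neq0 (A (rshift n j)); rewrite b0 xpair_eqE eqxx andbT.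
rewrite /line /= b0 RtoC0 mul0r addr0 /abscissa.
set a := x_coef _ in a0 *; set c := const_coef _.
have a0' : RtoC a != 0 by apply: contra_neq a0 => /(@RtoC_inj R a 0).
have aE : RtoC a * RtoC (- (c / a)) = - RtoC c.
  by rewrite -RtoCM mulrN mulrC divfK // RtoCN.
split=> [h|->]; last by rewrite aE addNr.
by apply: (mulfI a0'); rewrite aE; apply/eqP; rewrite -addr_eq0 h.
Qed.

Lemma complementE x y : M (x, y) <-> base x /\ forall i, y != height i x.
Proof.
split=> [h|[bx hx] k].
  split=> [j|i]; first by apply/eqP => /(line_ver j x y); exact: (h (rshift n j)).
  by apply/eqP => /line_hor; exact: (h (lshift m i)).
case: (split_ordP k) => [i ->|j ->].
  by move=> /line_hor; apply/eqP.
by move=> /line_ver; apply/eqP.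
Qed.

Lemma mem_hor i x y : (lshift m i \in lines_through A (x, y)) = (y == height i x).
Proof. by rewrite inE; apply/asboolP/eqP => /line_hor. Qed.

Lemma mem_ver j x y : (rshift n j \in lines_through A (x, y)) = (x == RtoC (abscissa j)).
Proof. by rewrite inE; apply/asboolP/eqP => /line_ver. Qed.

Lemma abscissa_inj : injective abscissa.
Proof.
move=> j j' e; have [inj _ _ _] := hA; apply: (@rshift_inj n m); apply: inj.
by apply/seteqP; split=> -[x y] /line_ver h; apply/line_ver; rewrite h e.
Qed.

Lemma singular_base x y : singular_points A (x, y) -> exists j, x = RtoC (abscissa j).
Proof.
have [_ _ _ fib] := hA => sxy.
have [|k lE] := fib x; first by exists (x, y).
move: lE; case: (split_ordP k) => [i ->|j ->] lE; last first.
  by exists j; apply/(line_ver j x 0); rewrite lE.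
have : line A (lshift m i) (x + 1, height i (x + 1)) by apply/line_hor.
rewrite lE /= => /eqP; rewrite -subr_eq0 addrAC subrr add0r oner_eq0.
by [].
Qed.

Lemma height_crossing i j x : base x -> i != j -> height i x != height j x.
Proof.
move=> bx ij; apply/eqP => h.
have [j' xj'] : exists j', x = RtoC (abscissa j').
  apply: (@singular_base x (height i x)); rewrite /singular_points /multiplicity /=.
  apply: (@leq_trans #|[set lshift m i; lshift m j]%SET|).
    by rewrite cards2 (inj_eq (@lshift_inj n m)) ij.
  by apply/subset_leq_card/fintype.subsetP => k /set2P[] ->; rewrite mem_hor // h.
by have := bx j'; rewrite xj' eqxx.
Qed.

(** Distinct vertical lines are disjoint, so one of two lines through a point is horizontal. *)
Lemma singular_hor x y : (2 <= multiplicity A (x, y))%N -> exists i, y = height i x.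
Proof.
move=> m2; have [[i /eqP ->]|no] := pselect (exists i, y == height i x); first by exists i.
exfalso; move: m2; rewrite leqNgt ltnS => /negP; apply.
apply/card_le1_eqP => k k'; case: (split_ordP k) => [i ->|j ->].
  by rewrite mem_hor => h; case: no; exists i.
case: (split_ordP k') => [i ->|j' ->]; first by rewrite mem_hor => _ h; case: no; exists i.
rewrite !mem_ver => /eqP -> /eqP /RtoC_inj /abscissa_inj ->.
by [].
Qed.

Lemma cabs_le1 (z : CC R) : `|z| <= 1 -> cabs z <= 1.
Proof. by rewrite normrE_cabs (lecR (cabs z) 1). Qed.

Section Monodromy.
Variables (rho : 'I_(n + m) -> CC R) (L : local_system R (complement A)).
Hypothesis mono : has_monodromy rho L.
Variable F : affine_system M.
Hypothesis FE : forall (u : sing R (complement A) 1) f,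
  (forall t, val (u t) = f (val t 0 1)) -> lin F f = transport L u.

Lemma lin_meridian k P v : line A k P -> ~ line A k (P.1 + v.1, P.2 + v.2) ->
  (forall j, j != k -> forall z : CC R, cabs z <= 1 -> ~ line A j (P.1 + z * v.1, P.2 + z * v.2)) ->
  (forall t : R, ~ line A k (P.1 + unit_circle t * v.1, P.2 + unit_circle t * v.2)) ->
  lin F (fun t => (P.1 + unit_circle t * v.1, P.2 + unit_circle t * v.2)) = rho k.
Proof.
move=> kP kPv other circ.
have [|u uE] := @realizes_exists R M (fun t => (P.1 + unit_circle t * v.1, P.2 + unit_circle t * v.2)).
  split; first by prove_continuous.
  move=> t t01 j; have [->|jk] := eqVneq j k; first exact: circ.
  by apply: other => //; rewrite cabs_unit.
rewrite (FE uE); apply: mono; exists P, v; split => //.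
by move=> j jk z /cabs_le1; exact: other.
Qed.

Lemma lin_horizontal i x (r : R) : base x -> 0 < r ->
  (forall j, j != i -> r < cabs (height j x - height i x)) ->
  lin F (fun t => (x, height i x + unit_circle t * RtoC r)) = rho (lshift m i).
Proof.
move=> bx r0 rj.
have r0' : RtoC r != 0 by apply/eqP => /(@RtoC_inj R r 0) h; move: r0; rewrite h ltxx.
have crc : cabs (RtoC r) = r by rewrite cabs_RtoC gtr0_norm.
have ne z : z != 0 -> ~ line A (lshift m i) (x + z * 0, height i x + z * RtoC r).
  move=> z0; rewrite mulr0 addr0 => /line_hor /eqP.
  by rewrite -[X in _ == X]addr0 (inj_eq (addrI _)) mulf_eq0 (negbTE z0) (negbTE r0').
rewrite -(@lin_meridian (lshift m i) (x, height i x) (0, RtoC r)) /=.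
- by congr (lin F _); apply/funext => t; rewrite mulr0 addr0.
- exact/line_hor.
- by have := ne 1; rewrite !mul1r; apply; exact: oner_neq0.
- move=> k ki z z1; rewrite mulr0 addr0; case: (split_ordP k) ki => [j ->|j ->] ki.
    move=> /line_hor h; have ji : j != i by apply: contra_neq ki => ->.
    have := rj j ji; rewrite -h addrAC subrr add0r cabsM crc.
    by have := cabs_ge0 z; nra.
  by move=> /line_ver xj; have := bx j; rewrite xj eqxx.
- by move=> t; apply: ne; exact: unit_circle_neq0.
Qed.

Lemma lin_vertical j0 (v1 v2 y : CC R) : v1 != 0 ->
  (forall j, j != j0 -> cabs v1 < cabs (RtoC (abscissa j) - RtoC (abscissa j0))) ->
  (forall i z, cabs z <= 1 -> y + z * v2 != height i (RtoC (abscissa j0) + z * v1)) ->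
  lin F (fun t => (RtoC (abscissa j0) + unit_circle t * v1, y + unit_circle t * v2)) =
    rho (rshift n j0).
Proof.
move=> v0 vj vi; have ne z w : z != 0 -> ~ line A (rshift n j0) (RtoC (abscissa j0) + z * v1, w).
  move=> z0 /line_ver /eqP.
  by rewrite -[X in _ == X]addr0 (inj_eq (addrI _)) mulf_eq0 (negbTE z0) (negbTE v0).
rewrite -(@lin_meridian (rshift n j0) (RtoC (abscissa j0), y) (v1, v2)) //=.
- exact/line_ver.
- by have := ne 1 (y + v2); rewrite mul1r; apply; exact: oner_neq0.
- move=> k kj z z1; case: (split_ordP k) kj => [i ->|j ->] kj.
    by move=> /line_hor; apply/eqP; exact: vi.
  have jj : j != j0 by apply: contra_neq kj => ->.
  move=> /line_ver h; have := vj j jj; rewrite -h addrAC subrr add0r cabsM.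
  by have := cabs_ge0 v1; have := cabs_ge0 z; nra.
- by move=> t; apply: ne; exact: unit_circle_neq0.
Qed.

End Monodromy.

(* If there is no such point, then every affine extension of the local system has
   a flat section. *)
Lemma generic_point rho p : characteristic_variety A rho -> (forall k, rho k != 1) ->
  (fst @` singular_points A) p ->
  exists2 i, (3 <= multiplicity A (p, height i p))%N &
    \prod_(k in lines_through A (p, height i p)) rho k = 1.
Proof.
move=> [_ [L mono H1]] rho1 [[p' y0] sing0 /= p'p]; subst p'.
(* The horizontal line [i0] through the singular point provides the monodromy different from 1 that
   makes flat sections unique. *)
have [j0 pE] := singular_base sing0; have [i0 _] := singular_hor sing0.
apply: contrapT => none.
have heightp i : height i p = RtoC (crossing_height slope_of icept_of abscissa j0 i).
  by rewrite /crossing_height RtoCD RtoCM -pE.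
have local i : (exists2 i', i' != i & crossing_height slope_of icept_of abscissa j0 i' =
      crossing_height slope_of icept_of abscissa j0 i) ->
    rho (rshift n j0) * \prod_(j | crossing_height slope_of icept_of abscissa j0 j ==
      crossing_height slope_of icept_of abscissa j0 i) rho (lshift m j) != 1.
  move=> [i' i'i qq]; apply/eqP => prod1; apply: none; exists i.
    apply: (@leq_trans #|[set lshift m i; lshift m i'; rshift n j0]%SET|).
      rewrite finset.setUC cardsU1 cards2 (inj_eq (@lshift_inj n m)) eq_sym i'i.
      by rewrite !inE !eq_rlshift.
    apply/subset_leq_card/fintype.subsetP => k /finset.setUP[/finset.set2P[]|/finset.set1P] ->.
    - by rewrite mem_hor.
    - by rewrite mem_hor !heightp qq.
    - by rewrite mem_ver pE.
  rewrite big_split_ord /= (eq_bigl (fun j => crossing_height slope_of icept_of abscissa j0 j ==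
      crossing_height slope_of icept_of abscissa j0 i)); last first.
    by move=> j; rewrite mem_hor !heightp (inj_eq (@RtoC_inj R)) eq_sym.
  rewrite (big_pred1 j0) 1?mulrC // => j.
  by rewrite mem_ver pE (inj_eq (@RtoC_inj R)) (inj_eq abscissa_inj) eq_sym.
have flatM : forall F : affine_system M,
    (forall (u : sing R (complement A) 1) f,
      (forall t, val (u t) = f (val t 0 1)) -> lin F f = transport L u) ->
    exists psi, flat F M psi.
  move=> F FE.
  have [x [bx ex]] := flat_near_vertical complementE height_crossing abscissa_inj
    (lin_horizontal mono FE) (@lin_vertical rho L mono F FE j0) (rho1 _) local.
  exact: (flat_global complementE height_crossing (rho1 _) (lin_horizontal mono FE (i := i0)) bx ex).
move: H1; apply: flat_H1_eq0 => tra traP.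
pose F := sing_system (transport_neq0 L) (transport_comp L) traP.
have [|psi fl] := flatM F; first by move=> u f; exact: lin_sing_system.
by exists (fun w : sing R (complement A) 0 => psi (val ((w : continuousType _ _) (vertex R)))); exact: flat_sing fl.
Qed.

End FiberedArrangement.

Theorem theorem2p9 (R : realType) (n m : nat) (A : 'I_(n + m) -> real_line R)
    (hA : real_fibered_arrangement A) (Z : set ('I_(n + m) -> CC R))
    (hZ : global_component A Z) :
  Z `<=` W_variety A.
Proof.
have [[irr ZV _] glob] := hZ; have [ZT _ _] := irr.
move=> rho0 Zrho0; split; first exact: ZT.
move=> p sp.
(* Z is covered by finitely many monomial equations: rho_k = 1 for [inl k], and for [inr i] the
   product at the point of line i over p. By irreducibility one of them holds on all of Z, and [inl]
   is excluded because the component is global. *)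
pose S (c : 'I_(n + m) + 'I_n) : {set 'I_(n + m)} := match c with
  | inl k => [set k]%SET
  | inr i => lines_through A (p, height (slope_of A) (icept_of A) i p)
  end.
pose s := [seq c <- enum {: 'I_(n + m) + 'I_n} | match c with
  | inl _ => true
  | inr i => (3 <= multiplicity A (p, height (slope_of A) (icept_of A) i p))%N
  end].
have [|[k _ Zk|i]] := @irreducible_monomials R (n + m) _ s S Z irr.
- move=> rho Zrho.
  have [[k rk]|nk] := pselect (exists k, rho k = 1).
    by exists (inl k); [rewrite mem_filter mem_enum|rewrite /S big_set1].
  have [|i m3 pr] := generic_point hA (ZV _ Zrho) _ sp.
    by move=> k; apply/eqP => rk; apply: nk; exists k.
  by exists (inr i) => //; rewrite mem_filter mem_enum andbT.
- by exfalso; apply: (glob k) => rho /Zk; rewrite /S big_set1.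
rewrite mem_filter => /andP[m3 _] Zi.
set T := (X in \big[_/_]_(P \in X) _).
have T0 : T (p, height (slope_of A) (icept_of A) i p) by split=> //; exact: leq_trans m3.
rewrite (fsbigD1 _ _ _ _ T0) /=; first by rewrite (Zi _ Zrho0) subrr mul0r.
(* Splitting off a factor requires a finite index set: the points in question lie on horizontal
   lines over p. *)
apply: (@sub_finite_set _ _ [set` [seq (p, height (slope_of A) (icept_of A) j p) | j <- enum 'I_n]]).
  move=> [x y] [sing_xy /= xp _]; subst x.
  have [j ->] := singular_hor hA sing_xy.
  by apply/mapP; exists j; rewrite ?mem_enum.
exact: finite_seq.
Qed.
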